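(* Let $p\in(2,3)$ and let $S\in\Omega_p$ be a price path with associated sequence of partitions $(\mathcal{P}^n)_{n\in\mathbb{N}}$ of $[0,\infty)$. Let $d_A\in\mathbb{N}$, let $A:[0,\infty)\to\mathbb{R}^{d_A}$ be a càdlàg path of locally bounded variation whose set of jump times $J_A:=\{t\in(0,\infty):A_{t-,t}\ne0\}$ satisfies $J_A\subseteq\bigcup_{n\in\mathbb{N}}\mathcal{P}^n$, and set $\ell=d+d_A$. For $f,\tilde f\in C^2_b(\mathbb{R}^\ell;\mathbb{R}^d)$ let $\phi^f_t:=f(S_t,A_t)$ and $\phi^{\tilde f}_t:=\tilde f(S_t,A_t)$, $t\in[0,\infty)$. Then $\phi^f\in\mathcal{A}_S$ is an admissible strategy, and the capital process $$V^f_t(S)=\lim_{n\to\infty}\sum_{[u,v]\in\mathcal{P}^n}\sum_{i=1}^d\phi^{f,i}_u\,(S^i_{v\wedge t}-S^i_{u\wedge t}),\qquad t\in[0,\infty),$$ is well-defined as a locally uniform limit in $t\in[0,\infty)$. Moreover, for every $T\in[0,\infty)$ we have the stability estimate $$|V^f_T(S)-V^{\tilde f}_T(S)|\le C\,\|f-\tilde f\|_{C^2_b}\,\big(1+\|S\|_{p,[0,T]}^2+\|A\|_{1,[0,T]}\big)\big(1+\|S\|_{p,[0,T]}\big)\|\mathbf{S}\|_{p,[0,T]},$$ where the constant $C$ depends only on $p$, and $\mathbf{S}=(S,S,\mathbb{S})$ is the càdlàg rough path associated with $S$ by Property (RIE).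
   Context: Fix $d\in\mathbb{N}$. $D([0,T];E)$ is the space of càdlàg functions $[0,T]\to E$, and $\Delta_{[0,T]}:=\{(s,t)\in[0,T]^2:s\le t\}$. For a path $A$ write $A_{s,t}:=A_t-A_s$ and $A_{t-,t}:=A_t-A_{t-}$; for a two-parameter function, $A_{s,t}$ is its value at $(s,t)$. $[u,v]\in\mathcal{P}$ means that $u<v$ are consecutive points of $\mathcal{P}$, and $|\mathcal{P}|$ is the mesh size. $(a\otimes b)^{ij}=a^ib^j$. $p$-variation ($p\ge1$): $\|A\|_{p,[s,t]}:=\big(\sup_{\mathcal{P}}\sum_{[u,v]\in\mathcal{P}}|A_{u,v}|^p\big)^{1/p}$, the supremum being over finite partitions of $[s,t]$ (for paths or two-parameter functions). $D^p$: càdlàg paths on $[0,T]$ of finite $p$-variation. $D^p_2$: functions on $\Delta_{[0,T]}$ of finite $p$-variation, càdlàg in each variable separately. A control function is a map $w:\Delta_{[0,T]}\to[0,\infty)$ with $w(s,u)+w(u,t)\le w(s,t)$ for $s\le u\le t$. $C^2_b(\mathbb{R}^\ell;\mathbb{R}^d)$: twice continuously differentiable functions with $\|f\|_{C^2_b}:=\|f\|_\infty+\|\mathrm{D}f\|_\infty+\|\mathrm{D}^2f\|_\infty<\infty$. Property (RIE): Let $p\in(2,3)$ and let $\mathcal{P}^n=\{0=t^n_0<\cdots<t^n_{N_n}=T\}$, $n\in\mathbb{N}$, be nested partitions ($\mathcal{P}^n\subset\mathcal{P}^{n+1}$) of $[0,T]$ with $|\mathcal{P}^n|\to0$. For $S\in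 D([0,T];\mathbb{R}^d)$ set $S^n_t=S_T\mathbf{1}_{\{T\}}(t)+\sum_{k=0}^{N_n-1}S_{t^n_k}\mathbf{1}_{[t^n_k,t^n_{k+1})}(t)$ and $\int_0^tS^n_u\otimes\mathrm{d}S_u:=\sum_{k=0}^{N_n-1}S_{t^n_k}\otimes S_{t^n_k\wedge t,t^n_{k+1}\wedge t}$, with $\int_s^t:=\int_0^t-\int_0^s$. $S$ satisfies (RIE) with respect to $p$ and $(\mathcal{P}^n)$ if: (a) $S^n\to S$ uniformly; (b) $\int_0^\cdot S^n_u\otimes\mathrm{d}S_u$ converges uniformly on $[0,T]$ to a limit, denoted $\int_0^\cdot S_u\otimes\mathrm{d}S_u$; (c) there is a control function $w$ such that (with $\frac00:=0$) $$\sup_{(s,t)\in\Delta_{[0,T]}}\frac{|S_{s,t}|^p}{w(s,t)}+\sup_{n}\sup_{0\le k<\ell\le N_n}\frac{\big|\int_{t^n_k}^{t^n_\ell}S^n_u\otimes\mathrm{d}S_u-S_{t^n_k}\otimes S_{t^n_k,t^n_\ell}\big|^{p/2}}{w(t^n_k,t^n_\ell)}\le1.$$ The associated càdlàg rough path is $\mathbf{S}=(S,S,\mathbb{S})$ with $\mathbb{S}_{s,t}:=\int_0^tS_u\otimes\mathrm{d}S_u-\int_0^sS_u\otimes\mathrm{d}S_u-S_s\otimes S_{s,t}$, and $\|\mathbf{S}\|_{p,[0,T]}:=2\|S\|_{p,[0,T]}+\|\mathbb{S}\|_{p/2,[0,T]}$. Price path: $S\in D([0,\infty);\mathbb{R}^d)$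 is a price path, $S\in\Omega_p$, if there is a nested sequence of locally finite partitions $(\mathcal{P}^n)$ of $[0,\infty)$ with mesh vanishing on compacts such that for all $T>0$ the restriction $S|_{[0,T]}$ satisfies (RIE) with respect to $p$ and $(\mathcal{P}^n([0,T]))_n$, where $\mathcal{P}^n([0,T]):=(\mathcal{P}^n\cup\{0,T\})\cap[0,T]$. Controlled paths: for $q\ge p$ with $2/p+1/q>1$ and $1/r=1/p+1/q$, $(F,F')\in\mathcal{V}^{q,r}_S$ (on $[0,T]$) means $F\in D^p([0,T];\mathbb{R}^d)$, $F'\in D^q([0,T];\mathcal{L}(\mathbb{R}^d;\mathbb{R}^d))$ and $R^F\in D^r_2(\Delta_{[0,T]};\mathbb{R}^d)$, where $R^F_{s,t}:=F_{s,t}-F'_sS_{s,t}$. Admissible strategy: $\phi:[0,\infty)\to\mathbb{R}^d$ is admissible with respect to $S\in\Omega_p$, $\phi\in\mathcal{A}_S$, if there exist $q\ge p$, $r>1$ with $2/p+1/q>1$, $1/r=1/p+1/q$ such that for every $T>0$ there is $\phi':[0,T]\to\mathcal{L}(\mathbb{R}^d;\mathbb{R}^d)$ with $(\phi,\phi')\in\mathcal{V}^{q,r}_S$ on $[0,T]$, and if the set of jump times of $\phi$ in $(0,\infty)$ is contained in $\bigcup_n\mathcal{P}^n$. *)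

(* Defs.v *)
(* Paths are total functions on R, of which only the values
   on [0, T] or [0, +oo[ are used. Vectors of R^d are rows 'rV[R]_d. A linear map
   in L(R^d; R^m) is a matrix M : 'M[R]_(d, m) acting on rows by v |-> v *m M. *)
From HB Require Import structures.
From mathcomp Require Import all_boot all_order all_algebra.
From mathcomp Require Import all_classical all_reals all_analysis.
Import Order.TTheory GRing.Theory Num.Theory.
Import numFieldNormedType.Exports.

Set Implicit Arguments.
Unset Strict Implicit.
Unset Printing Implicit Defensive.

Local Open Scope classical_set_scope.
Local Open Scope ring_scope.

Section Paths.
Variable R : realType.

(* The norm |.| is the Euclidean (Hilbert-Schmidt) norm; the library's norm on
   matrices is the max norm, used here only through the topology it induces. *)
Definition enorm (m n : nat) (M : 'M[R]_(m, n)) : R :=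
  Num.sqrt (\sum_i \sum_j M i j ^+ 2).

(* Within D, the right filter at the last point of D and the left filter at its
   first point are improper, hence the corresponding condition is void there. *)
Definition cadlag (V : normedModType R) (D : set R) (f : R -> V) : Prop :=
  forall t, D t ->
    f x @[x --> within D t^'+] --> f t /\ cvg (f x @[x --> within D t^'-]).

Definition jump_times (V : normedModType R) (f : R -> V) : set R :=
  [set t | 0 < t /\ f t - lim (f x @[x --> t^'-]) != 0].

Definition incr (V : normedModType R) (f : R -> V) (s t : R) : V := f t - f s.

Definition pvar (m n : nat) (q : R) (F : R -> R -> 'M[R]_(m, n)) (s t : R) :
    \bar R :=
  poweR (ereal_sup
    [set (\sum_(0 <= k < size c)
             enorm (F (nth s (s :: c) k) (nth s c k)) `^ q)%:E
       | c in [set c : seq R | itv_partition s t c]]) q^-1.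

Definition Dp (m n : nat) (T q : R) (F : R -> 'M[R]_(m, n)) : Prop :=
  cadlag `[0, T] F /\ (pvar q (incr F) 0 T < +oo)%E.

Definition Dp2 (m n : nat) (T q : R) (F : R -> R -> 'M[R]_(m, n)) : Prop :=
  [/\ forall t, t \in `[0, T] -> cadlag `[0, t] (F ^~ t),
      forall s, s \in `[0, T] -> cadlag `[s, T] (F s)
    & (pvar q F 0 T < +oo)%E].

Definition control (T : R) (w : R -> R -> R) : Prop :=
  (forall s t, 0 <= s -> s <= t -> t <= T -> 0 <= w s t) /\
  (forall s u t, 0 <= s -> s <= u -> u <= t -> t <= T ->
     w s u + w u t <= w s t).

(* Partitions are given by their sets of points. *)
Definition subitvs (P : set R) : set (R * R) :=
  [set uv | [/\ P uv.1, P uv.2, uv.1 < uv.2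
             & forall x, P x -> ~ (uv.1 < x < uv.2)]].

Definition mesh (P : set R) : R := sup [set uv.2 - uv.1 | uv in subitvs P].

Definition fin_partition (T : R) (P : set R) : Prop :=
  [/\ finite_set P, P `<=` `[0, T], P 0 & P T].

Definition locfin_partition (P : set R) : Prop :=
  [/\ P `<=` `[0, +oo[, P 0, forall T : R, finite_set (P `&` `[0, T])
    & forall T : R, exists2 t, P t & T < t].

Definition restr_partition (P : set R) (T : R) : set R :=
  (P `|` [set 0; T]) `&` `[0, T].

Definition nested (P : nat -> set R) : Prop := forall n, P n `<=` P n.+1.

Section RIE.
Variable d : nat.
Implicit Types (S : R -> 'rV[R]_d) (P : set R).

Definition tens (a b : 'rV[R]_d) : 'M[R]_d := a^T *m b.

Definition discretized P T S (t : R) : 'rV[R]_d :=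
  \1_[set T] t *: S T +
  \sum_(uv \in subitvs P) \1_(`[uv.1, uv.2[%classic) t *: S uv.1.

Definition discr_int P S (t : R) : 'M[R]_d :=
  \sum_(uv \in subitvs P) tens (S uv.1) (S (Num.min uv.2 t) - S (Num.min uv.1 t)).

(* The division of \bar R satisfies 0 / 0 = 0, and x / 0 = +oo for x > 0. *)
Definition eratio (x y : R) : \bar R := (x%:E / y%:E)%E.

Definition RIE (T p : R) (P : nat -> set R) S : Prop :=
  [/\ [/\ forall n, fin_partition T (P n), nested P
        & mesh (P n) @[n --> \oo] --> (0 : R)],
      {uniform `[0, T]%classic, (fun n => discretized (P n) T S) @ \oo --> S},
      exists I : R -> 'M[R]_d,
        {uniform `[0, T]%classic, (fun n => discr_int (P n) S) @ \oo --> I}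
    & exists2 w : R -> R -> R, control T w &
        (ereal_sup [set eratio (enorm (incr S st.1 st.2) `^ p) (w st.1 st.2)
                      | st in [set st : R * R | (0 <= st.1 <= st.2)%R /\
                                                (st.2 <= T)%R]] +
         ereal_sup [set x | exists n s t, [/\ P n s, P n t, (s < t)%R &
            x = eratio (enorm (discr_int (P n) S t - discr_int (P n) S s -
                              tens (S s) (incr S s t)) `^ (p / 2)) (w s t)]]
         <= 1)%E].

Definition rie_int (P : nat -> set R) S (t : R) : 'M[R]_d :=
  lim (discr_int (P n) S t @[n --> \oo]).

Definition rie_area (P : nat -> set R) S (s t : R) : 'M[R]_d :=
  rie_int P S t - rie_int P S s - tens (S s) (incr S s t).

Definition rough_norm (T p : R) (P : nat -> set R) S : \bar R :=
  (2%:E * pvar p (incr S) 0 T + pvar (p / 2) (rie_area P S) 0 T)%E.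

(* S belongs to Omega_p, with associated sequence of partitions P. *)
Definition price_path (p : R) (P : nat -> set R) S : Prop :=
  [/\ cadlag `[0, +oo[ S,
      forall n, locfin_partition (P n), nested P,
      forall T : R, 0 < T ->
        mesh (restr_partition (P n) T) @[n --> \oo] --> (0 : R)
    & forall T : R, 0 < T -> RIE T p (fun n => restr_partition (P n) T) S].

Definition remainder S (F : R -> 'rV[R]_d) (F' : R -> 'M[R]_d) (s t : R) :
    'rV[R]_d :=
  incr F s t - incr S s t *m F' s.

Definition controlled (T p q r : R) S (F : R -> 'rV[R]_d) (F' : R -> 'M[R]_d) :
    Prop :=
  [/\ Dp T p F, Dp T q F' & Dp2 T r (remainder S F F')].

Definition admissible (p : R) (P : nat -> set R) S (phi : R -> 'rV[R]_d) :
    Prop :=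
  (exists q r : R,
     [/\ p <= q, 1 < r, 1 < 2 / p + 1 / q, 1 / r = 1 / p + 1 / q &
         forall T : R, 0 < T ->
           exists phi' : R -> 'M[R]_d, controlled T p q r S phi phi']) /\
  jump_times phi `<=` \bigcup_n P n.

Definition discr_capital P S (phi : R -> 'rV[R]_d) (t : R) : R :=
  \sum_(uv \in subitvs P)
     \sum_(i < d) phi uv.1 0 i *
                  (S (Num.min uv.2 t) 0 i - S (Num.min uv.1 t) 0 i).

Definition capital (P : nat -> set R) S (phi : R -> 'rV[R]_d) (t : R) : R :=
  lim (discr_capital (P n) S phi t @[n --> \oo]).

End RIE.

Section C2b.
Variables l m : nat.
Implicit Type f : 'rV[R]_l -> 'rV[R]_m.

(* D f is represented by jacobian f, and D^2 f x by the linear map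
   v |-> 'd (jacobian f) x v, whose Hilbert-Schmidt norm is taken. In finite
   dimension, continuity of D^2 f amounts to continuity for each fixed v. *)
Definition hess_norm f (x : 'rV[R]_l) : R :=
  Num.sqrt (\sum_(k < l) enorm ('d (jacobian f) x (delta_mx 0 k)) ^+ 2).

Definition C2b_norm f : \bar R :=
  (ereal_sup (range (fun x => (enorm (f x))%:E)) +
   ereal_sup (range (fun x => (enorm (jacobian f x))%:E)) +
   ereal_sup (range (fun x => (hess_norm f x)%:E)))%E.

Definition C2b f : Prop :=
  [/\ forall x, differentiable f x,
      forall x, differentiable (jacobian f) x,
      forall v, continuous (fun x => 'd (jacobian f) x v)
    & (C2b_norm f < +oo)%E].

End C2b.

End Paths.

(* Main.v *)
(* With phi = f(S, A), phi' = D_S f(S, A) and the areas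
   SS^n_{s,t} = int_s^t S^n dS - S_s (x) S_{s,t}, which vanish on the intervals
   of P^n, the n-th capital process is the sum over P^n of the germ
   phi_s . S_{s,t} + phi'_s : SS^n_{s,t}. The defect of additivity of the germ is
   O(w^(3/p)) for a control w that does not depend on n, so Young's argument
   (removing the partition points one by one, cheapest first) bounds the cost of
   passing from P^n to a coarser P^k. As w may jump, this cost is small only
   because S and A oscillate little on [u, v[ for [u, v] in P^k: the defect is
   then also O(eps), and interpolating the two bounds keeps an exponent above 1.
   For a fixed P^k, replacing SS^n by its limit SS is harmless by uniform
   convergence; hence the capital is a uniform limit, approximated by sums over
   P^k of the limiting germ. Young's argument on these sums, now with the
   p-variations of S, A and SS as weights, gives the stability estimate, because
   the capital is linear in f. *)
Require Import Defs.
From HB Require Import structures.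
From mathcomp Require Import all_boot all_order all_algebra.
From mathcomp Require Import all_classical all_reals all_analysis.
From mathcomp Require Import finmap ring lra.
Import Order.TTheory GRing.Theory Num.Theory.
Import numFieldNormedType.Exports.
Set Implicit Arguments.
Unset Strict Implicit.
Unset Printing Implicit Defensive.
Local Open Scope classical_set_scope.
Local Open Scope ring_scope.

(** * Sums over partitions and Young's sewing argument *)

Section PartitionSums.
Variables (R : realType) (V : zmodType).
Implicit Types (F G : R -> R -> V) (x y z : R) (s : seq R).

(** Why the order is 3/p: an increment of S counts 1/p and an area 2/p, while an increment of A, of
    order 1, may be used at 1/p or at 2/p since p > 2. Every product in the defect then has total
    order 3/p, which exceeds 1 because p < 3. Two obstacles shape the proof. First, (RIE) bounds the
    areas only between points of P^n, whereas the integral is stopped at an arbitrary t; Chen's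
    relation at the last partition point before t extends the bound. Secondly, w is not bounded by
    the p-variations of S and of the area, so the weights that give convergence cannot give a
    constant depending on p alone. In the second use of Young's argument each increment is therefore
    divided by the corresponding variation over [0, T]; each of the three normalised sums is at most
    1, and the variations reappear only as factors of the defect. Partitions are lists there,
    because Young's argument deletes one point at a time; the sums over sets of intervals are
    converted to lists once. *)

Fixpoint psum F x s : V :=
  if s is y :: s' then F x y + psum F y s' else 0.

Lemma psum_nth F x s : psum F x s =
  \sum_(0 <= k < size s) F (nth x (x :: s) k) (nth x s k).
Proof.
elim: s x => [|y s ih] x /=; first by rewrite big_nil.
rewrite big_nat_recl //= ih; congr (_ + _); apply: eq_big_nat => k /andP[_ ks].
by congr F; apply: set_nth_default => //=; rewrite ltnS ltnW.
Qed.

Lemma psum_cat F x s1 s2 : psum F x (s1 ++ s2) = psum F x s1 + psum F (last x s1) s2.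
Proof. by elim: s1 x => [|y s ih] x /=; rewrite ?add0r // ih addrA. Qed.

Lemma psumD F G x s : psum (fun u v => F u v + G u v) x s = psum F x s + psum G x s.
Proof. by elim: s x => [|y s ih] x /=; rewrite ?addr0 // ih addrACA. Qed.

Lemma psumB F G x s : psum (fun u v => F u v - G u v) x s = psum F x s - psum G x s.
Proof. by elim: s x => [|y s ih] x /=; rewrite ?subr0 // ih opprD addrACA. Qed.

Lemma psum_telescope (h : R -> V) x s :
  psum (fun u v => h v - h u) x s = h (last x s) - h x.
Proof.
by elim: s x => [|y s ih] x /=; rewrite ?subrr // ih addrC addrA subrK.
Qed.

Lemma eq_psum_consecutive F G x s :
  (forall s1 u v s2, x :: s = s1 ++ u :: v :: s2 -> F u v = G u v) ->
  psum F x s = psum G x s.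
Proof.
elim: s x => [//|y s ih] x FG /=; congr (_ + _).
  exact: (FG [::] x y s).
by apply: ih => s1 u v s2 e; apply: (FG (x :: s1) u v s2); rewrite e.
Qed.

End PartitionSums.

Section RealPartitionSums.
Variable R : realType.
Implicit Types (F G W : R -> R -> R) (x y z : R) (s : seq R).

Lemma ler_psum_consecutive F G x s :
  (forall s1 u v s2, x :: s = s1 ++ u :: v :: s2 -> F u v <= G u v) ->
  psum F x s <= psum G x s.
Proof.
elim: s x => [//|y s ih] x FG /=; apply: lerD.
  exact: (FG [::] x y s).
by apply: ih => s1 u v s2 e; apply: (FG (x :: s1) u v s2); rewrite e.
Qed.

Lemma psumZ (c : R) F x s : psum (fun u v => c * F u v) x s = c * psum F x s.
Proof. by elim: s x => [|y s ih] x /=; rewrite ?mulr0 // ih mulrDr. Qed.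

Lemma ler_norm_psum F x s : `|psum F x s| <= psum (fun u v => `|F u v|) x s.
Proof.
elim: s x => [|y s ih] x /=; rewrite ?normr0 //.
by apply: (le_trans (ler_normD _ _)); apply: lerD.
Qed.

Lemma psum_const (c : R) x s : psum (fun _ _ => c) x s = c *+ size s.
Proof. by elim: s x => [|y s ih] x //=; rewrite ih -mulrS. Qed.

Lemma path_le_last x s a : path <%R x s -> a \in x :: s -> a <= last x s.
Proof.
elim: s x a => [|y s ih] x a /=; first by rewrite !inE => _ /eqP->.
move=> /andP[xy ys]; rewrite inE => /orP[/eqP->|]; last exact: ih.
by apply: (le_trans (ltW xy)); apply: ih => //; rewrite mem_head.
Qed.

Lemma path_ge_head x s a : path <%R x s -> a \in x :: s -> x <= a.
Proof.
move=> /(order_path_min lt_trans) /allP h; rewrite inE => /orP[/eqP->//|/h].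
exact: ltW.
Qed.

Lemma path_consecutive x s1 u v s2 s : path <%R x s ->
  x :: s = s1 ++ u :: v :: s2 ->
  [/\ u \in x :: s, v \in s, u < v &
      forall a, a \in x :: s -> a <= u \/ v <= a].
Proof.
move=> + e; have -> : path <%R x s = sorted <%R (s1 ++ u :: v :: s2) by rewrite -e.
rewrite (sorted_pairwise lt_trans) pairwise_cat /= => /and3P[/allrelP h1 _].
move=> /andP[/andP[uv /allP h3] /andP[/allP h4 _]].
have um : u \in x :: s by rewrite e mem_cat mem_head orbT.
split => //.
  case: s1 e h1 => [|b s1] /= [_ ->] _; first by rewrite mem_head.
  by rewrite mem_cat !inE eqxx !orbT.
move=> a; rewrite e mem_cat !inE => /orP[am|/or3P[/eqP->|/eqP->|am]].
- by left; apply/ltW/h1 => //; rewrite mem_head.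
- by left.
- by right.
- by right; apply/ltW/h4.
Qed.

Lemma path_del x s1 y z s2 : path <%R x (s1 ++ y :: z :: s2) ->
  [/\ path <%R x (s1 ++ z :: s2), last x s1 < y & y < z].
Proof.
rewrite !cat_path /= => /and4P[-> ly yz ->]; split=> //.
by rewrite (lt_trans ly yz).
Qed.

End RealPartitionSums.

(** * Removal of partition points by pigeonhole, and its total cost *)

Section Sewing.
Variable R : realType.
Implicit Types (x y z : R) (s : seq R) (q : pred R).

Lemma psum_del (V : zmodType) (F : R -> R -> V) x s1 y z s2 :
  psum F x (s1 ++ y :: z :: s2) - psum F x (s1 ++ z :: s2) =
  F (last x s1) y + F y z - F (last x s1) z.
Proof. by rewrite !psum_cat /= opprD addrACA subrr add0r !addrA opprD addrA addrAC addrK. Qed.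

(** Pigeonhole in contrapositive form: summing the two-sided weights over the removable points
    counts each interval at most twice. *)
Lemma small_removable (W : R -> R -> R) q (c : R) x s :
  (forall u v, u \in x :: s -> v \in x :: s -> 0 <= W u v) ->
  q (last x s) ->
  (forall s1 y z s2, s = s1 ++ y :: z :: s2 -> ~~ q y ->
     c < W (last x s1) y + W y z) ->
  (0 < count (predC q) s)%N ->
  c * (count (predC q) s)%:R < 2 * psum W x s.
Proof.
move=> W0 qx h n0.
(* The first interval is counted only once, because its left end [x] is not a point of [s]; keeping
   this slack makes the induction work. *)
suff [_ /(_ n0)] : c * (count (predC q) s)%:R <= 2 * psum W x s -
      (if s is y :: _ then W x y else 0) /\
    ((0 < count (predC q) s)%N -> c * (count (predC q) s)%:R < 2 * psum W x s -
      (if s is y :: _ then W x y else 0)).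
  move=> /lt_le_trans; apply; rewrite gerBl; case: s {h qx n0} W0 => // y s.
  by apply; rewrite !inE eqxx ?orbT.
elim: s x W0 qx h {n0} => [|y s ih] x W0 qx h /=; first by rewrite !mulr0 subr0.
have {}ih := ih y (fun u v us vs => W0 u v (mem_behead (s := x :: y :: s) us)
  (mem_behead (s := x :: y :: s) vs)) qx.
have Wxy : 0 <= W x y by rewrite W0 ?inE ?eqxx ?orbT.
case: s ih W0 qx h => [|z s] ih W0 qx h; first by rewrite /= in qx *; rewrite qx /=; split=> //; lra.
have /ih {ih}[ih1 ih2] s1 a b s2 : z :: s = s1 ++ a :: b :: s2 -> ~~ q a ->
    c < W (last y s1) a + W a b.
  by move=> e qa; apply: (h (y :: s1) a b s2); rewrite //= e.
have Wyz : 0 <= W y z by rewrite W0 ?inE ?eqxx ?orbT.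
have [qy|qy] /= := boolP (q y).
  by rewrite add0n; split=> [|/ih2] /=; rewrite /= in ih1 *; lra.
have := h [::] y z s erefl qy; rewrite /= in ih1 *.
by rewrite natrD mulrDr mulr1 => ?; split=> [|_]; lra.
Qed.

(** A bound for zeta(k + 1) by comparison with the integral: the terms after the first telescope
    against j^(-k) / k. *)
Lemma sum_invpow_le (k : R) (n : nat) : 0 < k ->
  \sum_(0 <= j < n) (j.+1)%:R `^ (- (k + 1)) <= 1 + k^-1.
Proof.
move=> k0; case: n => [|n]; first by rewrite big_nil addr_ge0 // invr_ge0 ltW.
have h j : (0 < j)%N ->
    k * j.+1%:R `^ (- (k + 1)) <= j%:R `^ (- k) - j.+1%:R `^ (- k) :> R.
  move=> j0; have jp : 0 < j%:R :> R by rewrite ltr0n.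
  have jp1 : 0 < j.+1%:R :> R by rewrite ltr0n.
  have -> : j%:R `^ (- k) = j.+1%:R `^ (- k) * (j%:R / j.+1%:R) `^ (- k) :> R.
    by rewrite -powRM ?divr_ge0// mulrCA divff ?mulr1// gt_eqF.
  rewrite opprD powRD; last by rewrite (gt_eqF jp1) implybT.
  rewrite powR_inv1 ?(ltW jp1)// mulrCA.
  rewrite -[X in _ <= _ - X]mulr1 -mulrBr.
  apply: ler_wpM2l; first exact: powR_ge0.
  have jj : 0 < j%:R / j.+1%:R :> R by rewrite divr_gt0.
  rewrite /powR (gt_eqF jj) lerBrDl.
  (* With x = j / (j + 1): x^(-k) = exp(-k ln x) >= 1 - k ln x, and ln x <= x - 1 = -1 / (j + 1). *)
  apply: le_trans (expR_ge1Dx _); rewrite lerD2l mulNr -mulrN ler_pM2l// lerNr.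
  have := @le_ln1Dx R (j%:R / j.+1%:R - 1); rewrite subrKC => /(_ _)/le_trans; apply.
    by rewrite ltrBrDr addrC subrr.
  rewrite lerBlDr -(@ler_pM2r _ j.+1%:R)// mulrDl mulNr mulVf ?gt_eqF// divfK ?gt_eqF//.
  by rewrite mul1r -natr1; lra.
rewrite big_nat_recl// powR1; apply: lerD => //.
rewrite -[leRHS]mul1r ler_pdivlMr// mulrC mulr_sumr.
apply: (@le_trans _ _ (\sum_(0 <= j < n) (j.+1%:R `^ (- k) - j.+2%:R `^ (- k)))).
  by apply: ler_sum_nat => j _; exact: h.
rewrite (@telescope_sumr_eq _ _ _ (fun j => - j.+1%:R `^ (- k))) //; last first.
  by move=> j _; rewrite opprK addrC.
by rewrite opprK powR1 addrC gerBl powR_ge0.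
Qed.

(* Young's argument: among n removable points, one has W-weight at most
   2 M / n, and removing it costs at most K (2 M / n) ^ th. *)
Lemma sewing (Xi W : R -> R -> R) q (K M th x : R) s :
  1 < th -> 0 <= K -> 0 <= M -> path <%R x s -> q x -> q (last x s) ->
  (forall u v, u \in x :: s -> v \in x :: s -> 0 <= W u v) ->
  (forall s', path <%R x s' -> last x s' = last x s -> {subset s' <= s} ->
     psum W x s' <= M) ->
  (forall u v w, u \in x :: s -> v \in s -> w \in s -> u < v -> v < w ->
     (forall a, u < a -> a < w -> a \in s -> ~~ q a) ->
     `|Xi u v + Xi v w - Xi u w| <= K * (W u v + W v w) `^ th) ->
  `|psum Xi x s - psum Xi x [seq a <- s | q a]| <=
    K * (1 + (th - 1)^-1) * (2 * M) `^ th.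
Proof.
move=> th1 K0 M0 + qx + + + +.
have C0 : 0 <= K * (2 * M) `^ th by rewrite mulr_ge0 ?powR_ge0.
(* Induction on the number of removable points: removing the cheapest of [n.+1] points costs the
   next term of the zeta series. The exponent is written [th - 1 + 1] to match [sum_invpow_le]. *)
suff main n : forall s, count (predC q) s = n ->
    path <%R x s -> q (last x s) ->
  (forall u v, u \in x :: s -> v \in x :: s -> 0 <= W u v) ->
  (forall s', path <%R x s' -> last x s' = last x s -> {subset s' <= s} ->
     psum W x s' <= M) ->
  (forall u v w, u \in x :: s -> v \in s -> w \in s -> u < v -> v < w ->
     (forall a, u < a -> a < w -> a \in s -> ~~ q a) ->
     `|Xi u v + Xi v w - Xi u w| <= K * (W u v + W v w) `^ th) ->
  `|psum Xi x s - psum Xi x [seq a <- s | q a]| <=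
    K * (2 * M) `^ th * \sum_(0 <= j < n) (j.+1)%:R `^ (- (th - 1 + 1)).
  move=> xs qs W0 WM XiW; apply: (le_trans (main _ _ erefl xs qs W0 WM XiW)).
  by rewrite [leRHS]mulrAC; apply: ler_wpM2l => //; rewrite sum_invpow_le// subr_gt0.
elim: n => [|n ih] {}s en xs qs W0 WM XiW.
  rewrite big_nil mulr0; have -> : [seq a <- s | q a] = s.
    apply/all_filterP; move/eqP: en; rewrite -leqn0 leqNgt -has_count.
    by rewrite has_predC negbK.
  by rewrite subrr normr0.
have [s1 [y [z [s2 [es qy Wyz]]]]] : exists s1 y z s2,
    [/\ s = s1 ++ y :: z :: s2, ~~ q y &
      W (last x s1) y + W y z <= 2 * M / n.+1%:R].
  apply: contrapT => H.
  have n0 : (0 < count (predC q) s)%N by rewrite en.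
  have := @small_removable W q (2 * M / n.+1%:R) x s W0 qs _ n0.
  rewrite en divfK ?pnatr_eq0// ltr_pM2l// ltNge WM// => /(_ _)/notF; apply.
  move=> s1 y z s2 es qy; rewrite ltNge; apply/negP => h.
  by apply: H; exists s1, y, z, s2.
subst s; have [ps ly yz] := path_del xs.
have sub : {subset s1 ++ z :: s2 <= s1 ++ [:: y, z & s2]}.
  by move=> a; rewrite !mem_cat [in X in _ -> X]inE => /orP[->//|->]; rewrite !orbT.
have sub1 : {subset x :: s1 ++ z :: s2 <= x :: s1 ++ [:: y, z & s2]}.
  by move=> a; rewrite !(in_cons x) => /orP[->//|/sub->]; rewrite orbT.
have eqf : [seq a <- s1 ++ z :: s2 | q a] = [seq a <- s1 ++ [:: y, z & s2] | q a].
  by rewrite !filter_cat /= (negbTE qy).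
have lastE : last x (s1 ++ z :: s2) = last x (s1 ++ [:: y, z & s2]).
  by rewrite !last_cat.
have cn : count (predC q) (s1 ++ z :: s2) = n.
  by move: en; rewrite !count_cat /= qy add1n addnS => -[].
have h1 : `|psum Xi x (s1 ++ z :: s2) - psum Xi x [seq a <- s1 ++ z :: s2 | q a]| <=
    K * (2 * M) `^ th * \sum_(0 <= j < n) (j.+1)%:R `^ (- (th - 1 + 1)).
  apply: ih => //.
  - by rewrite lastE.
  - by move=> u v /sub1 us /sub1; exact: W0.
  - by move=> s' ps' ls' ss'; apply: WM => //; rewrite ?ls' // => a /ss'/sub.
  - move=> u v w uS vS wS uv vw nq; apply: XiW => //; rewrite ?sub ?sub1//.
    move=> a ua aw; rewrite mem_cat !inE => am; have [-> //|ay] := eqVneq a y.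
    apply: nq => //; rewrite mem_cat inE.
    by move: am; rewrite (negbTE ay).
have h2 : `|psum Xi x (s1 ++ [:: y, z & s2]) - psum Xi x (s1 ++ z :: s2)| <=
    K * (2 * M) `^ th * n.+1%:R `^ (- (th - 1 + 1)).
  rewrite psum_del.
  apply: le_trans (XiW _ _ _ _ _ _ ly yz _) _.
  - have := mem_last x s1; rewrite !inE mem_cat => /orP[->//|->].
    by rewrite orbT.
  - by rewrite mem_cat mem_head orbT.
  - by rewrite mem_cat !inE eqxx !orbT.
  (* Strictly between the neighbours of [y] there is no other point of the list, so no kept point is
     skipped and the defect hypothesis applies. *)
  - move=> a la az am; suff -> : a = y by [].
    have e1 : x :: s1 ++ [:: y, z & s2] = belast x s1 ++ last x s1 :: y :: z :: s2.
      by rewrite -cat_cons lastI cat_rcons.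
    have e2 : x :: s1 ++ [:: y, z & s2] = rcons (belast x s1) (last x s1) ++ y :: z :: s2.
      by rewrite -cat_cons lastI.
    have am' : a \in x :: s1 ++ [:: y, z & s2] by rewrite inE am orbT.
    have [_ _ _ /(_ a am')[al|ya]] := path_consecutive xs e1; first by rewrite ltNge al in la.
    have [_ _ _ /(_ a am')[ay|za]] := path_consecutive xs e2; last by rewrite ltNge za in az.
    by apply/le_anti; rewrite ay ya.
  - rewrite -mulrA ler_wpM2l// subrK -mulN1r powRrM powR_inv1 ?ler0n// -powRM ?mulr_ge0//.
    apply: ge0_ler_powR; rewrite ?nnegrE; [lra| | |by []].
      by rewrite addr_ge0// W0 // ?inE ?mem_cat ?inE ?eqxx ?orbT//;
        have := mem_last x s1; rewrite inE => /orP[->|->]; rewrite ?orbT.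
    by rewrite !mulr_ge0.
rewrite big_nat_recr//= mulrDr -eqf [leRHS]addrC.
rewrite -[X in `|X|](subrKA (psum Xi x (s1 ++ z :: s2))).
by apply: (le_trans (ler_normD _ _)); apply: lerD.
Qed.
End Sewing.

(** * The Euclidean norm on matrices *)

Section Frobenius.
Variable R : realType.

Definition frob m n (A B : 'M[R]_(m, n)) : R := \sum_i \sum_j A i j * B i j.

Section Fixed.
Variables m n : nat.
Implicit Types A B C : 'M[R]_(m, n).

Lemma frobC A B : frob A B = frob B A.
Proof. by apply: eq_bigr => i _; apply: eq_bigr => j _; rewrite mulrC. Qed.

Lemma frobDl A B C : frob (A + B) C = frob A C + frob B C.
Proof.
rewrite -big_split; apply: eq_bigr => i _; rewrite -big_split.
by apply: eq_bigr => j _; rewrite mxE mulrDl.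
Qed.

Lemma frobZl (a : R) A B : frob (a *: A) B = a * frob A B.
Proof.
rewrite mulr_sumr; apply: eq_bigr => i _; rewrite mulr_sumr.
by apply: eq_bigr => j _; rewrite mxE mulrA.
Qed.

Lemma frobZr (a : R) A B : frob A (a *: B) = a * frob A B.
Proof. by rewrite frobC frobZl frobC. Qed.

Lemma frobNl A B : frob (- A) B = - frob A B.
Proof. by rewrite -scaleN1r frobZl mulN1r. Qed.

Lemma frobNr A B : frob A (- B) = - frob A B.
Proof. by rewrite frobC frobNl frobC. Qed.

Lemma frobBl A B C : frob (A - B) C = frob A C - frob B C.
Proof. by rewrite frobDl frobNl. Qed.

Lemma frobDr A B C : frob A (B + C) = frob A B + frob A C.
Proof. by rewrite ![frob A _]frobC frobDl. Qed.

Lemma frobBr A B C : frob A (B - C) = frob A B - frob A C.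
Proof. by rewrite ![frob A _]frobC frobBl. Qed.

Lemma frob0r A : frob A 0 = 0.
Proof. by apply: big1 => i _; apply: big1 => j _; rewrite mxE mulr0. Qed.

Lemma frob_ge0 A : 0 <= frob A A.
Proof. by apply: sumr_ge0 => i _; apply: sumr_ge0 => j _; rewrite -expr2 sqr_ge0. Qed.

Lemma enorm_ge0 A : 0 <= enorm A.
Proof. exact: sqrtr_ge0. Qed.

Lemma sqr_enorm A : enorm A ^+ 2 = frob A A.
Proof.
rewrite /enorm sqr_sqrtr; first by apply: eq_bigr => i _; apply: eq_bigr => j _; rewrite expr2.
by apply: sumr_ge0 => i _; apply: sumr_ge0 => j _; rewrite sqr_ge0.
Qed.

Lemma enorm_le A (x : R) : 0 <= x -> (enorm A <= x) = (frob A A <= x ^+ 2).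
Proof. by move=> x0; rewrite -sqr_enorm ler_sqr // nnegrE // enorm_ge0. Qed.

Lemma enorm0 : enorm (0 : 'M[R]_(m, n)) = 0.
Proof. by apply/eqP; rewrite -sqrf_eq0 sqr_enorm frob0r. Qed.

Lemma enorm_eq0 A : (enorm A == 0) = (A == 0).
Proof.
apply/eqP/eqP => [A0|->]; last exact: enorm0.
have /eqP := sqr_enorm A; rewrite A0 expr0n /= eq_sym psumr_eq0; last first.
  by move=> i _; apply: sumr_ge0 => j _; rewrite -expr2 sqr_ge0.
move=> /allP h; apply/matrixP => i j; rewrite mxE.
have /= := h i (mem_index_enum i); rewrite psumr_eq0; last first.
  by move=> k _; rewrite -expr2 sqr_ge0.
by move=> /allP/(_ j (mem_index_enum j)) /=; rewrite mulf_eq0 orbb => /eqP.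
Qed.

Lemma enormZ (a : R) A : enorm (a *: A) = `|a| * enorm A.
Proof.
apply/eqP; rewrite -(@eqrXn2 _ 2)// ?mulr_ge0 ?enorm_ge0//.
by rewrite exprMn !sqr_enorm frobZl frobC frobZl mulrA -expr2 real_normK ?num_real.
Qed.

Lemma enormN A : enorm (- A) = enorm A.
Proof. by rewrite -scaleN1r enormZ normrN normr1 mul1r. Qed.

Lemma enormBC A B : enorm (A - B) = enorm (B - A).
Proof. by rewrite -enormN opprB. Qed.

Lemma cauchy_schwarz A B : `|frob A B| <= enorm A * enorm B.
Proof.
have [B0|Bn] := eqVneq (enorm B) 0.
  by move/eqP: (B0); rewrite enorm_eq0 => /eqP ->; rewrite frob0r normr0 enorm0 mulr0.
have Bp : 0 < enorm B ^+ 2 by rewrite exprn_gt0// lt_neqAle eq_sym Bn enorm_ge0.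
rewrite -ler_sqr ?nnegrE ?mulr_ge0 ?enorm_ge0//.
rewrite real_normK ?num_real// exprMn -ler_pdivrMr//.
have := frob_ge0 (A - (frob A B / enorm B ^+ 2) *: B).
rewrite frobBl !frobBr !frobZl !frobZr -!sqr_enorm [frob B A]frobC.
have -> : frob A B / enorm B ^+ 2 * (frob A B / enorm B ^+ 2 * enorm B ^+ 2) =
  frob A B ^+ 2 / enorm B ^+ 2 by rewrite divfK ?gt_eqF// mulrAC.
have -> : frob A B / enorm B ^+ 2 * frob A B = frob A B ^+ 2 / enorm B ^+ 2 by rewrite mulrAC.
by lra.
Qed.

Lemma ler_enormD A B : enorm (A + B) <= enorm A + enorm B.
Proof.
rewrite enorm_le ?addr_ge0 ?enorm_ge0// frobDl !frobDr -!sqr_enorm [frob B A]frobC sqrrD.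
have := le_trans (ler_norm _) (cauchy_schwarz A B).
set x := enorm A ^+ 2; set y := enorm B ^+ 2; lra.
Qed.

Lemma ler_enormB A B : enorm (A - B) <= enorm A + enorm B.
Proof. by rewrite -(enormN B) ler_enormD. Qed.

Lemma enorm_distD B A C : enorm (A - C) <= enorm (A - B) + enorm (B - C).
Proof. by rewrite -{1}(subrKA B) ler_enormD. Qed.

Lemma ler_coord_enorm A i j : `|A i j| <= enorm A.
Proof.
rewrite -ler_sqr ?nnegrE ?enorm_ge0// real_normK ?num_real// sqr_enorm.
rewrite /frob (bigD1 i)//= (bigD1 j)//= -expr2 -addrA lerDl addr_ge0//.
  by apply: sumr_ge0 => k _; rewrite -expr2 sqr_ge0.
by apply: sumr_ge0 => k _; apply: sumr_ge0 => l _; rewrite -expr2 sqr_ge0.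
Qed.

Lemma enorm_le_sum A : enorm A <= \sum_i \sum_j `|A i j|.
Proof.
rewrite {1}(matrix_sum_delta A); elim/big_rec2: _ => [|i x y _ h]; first by rewrite enorm0.
apply: (le_trans (ler_enormD _ _)); apply: lerD => //.
elim/big_rec2: _ => [|j u v _ {}h]; first by rewrite enorm0.
apply: (le_trans (ler_enormD _ _)); apply: lerD => //.
rewrite enormZ -[leRHS]mulr1; apply: ler_wpM2l => //.
rewrite enorm_le// expr1n /frob (bigD1 i)//= (bigD1 j)//= !mxE !eqxx mulr1.
rewrite [X in _ + X + _]big1; last first.
  by move=> k kj; rewrite mxE (negbTE kj) andbF mulr0.
rewrite big1 ?addr0// => k ki; rewrite big1// => l _.
by rewrite mxE (negbTE ki) mulr0.
Qed.

Lemma normr_le_enorm A : `|A| <= enorm A.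
Proof.
have -> : `|A| = mx_norm A by []; rewrite mx_normrE; apply: (big_ind (fun x => x <= enorm A)) => //.
- exact: enorm_ge0.
- by move=> x y x0 y0; rewrite ge_max x0.
- by move=> i _; exact: ler_coord_enorm.
Qed.

Lemma coord_le_normr A i j : `|A i j| <= `|A|.
Proof.
have -> : `|A| = mx_norm A by []; rewrite mx_normrE.
by rewrite (le_bigmax _ (fun k => `|A k.1 k.2|) (i, j)).
Qed.

(** With [normr_le_enorm], equivalence with the max norm that defines limits. The dimensional factor
    only enters the choice of an epsilon, never the constant of the theorem. *)
Lemma enorm_le_normr A : enorm A <= (m * n)%:R * `|A|.
Proof.
apply: (le_trans (enorm_le_sum A)).
apply: (@le_trans _ _ (\sum_(i < m) \sum_(j < n) `|A|)).
  by apply: ler_sum => i _; apply: ler_sum => j _; exact: coord_le_normr.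
by rewrite !sumr_const !card_ord -mulrnA mulr_natl mulnC.
Qed.

End Fixed.

Lemma frob_row m n (A B : 'M[R]_(m, n)) : frob A B = \sum_i frob (row i A) (row i B).
Proof.
by apply: eq_bigr => i _; rewrite /frob big_ord1; apply: eq_bigr => j _; rewrite !mxE.
Qed.

Lemma enormT m n (A : 'M[R]_(m, n)) : enorm A^T = enorm A.
Proof.
apply/eqP; rewrite -(@eqrXn2 _ 2)// ?enorm_ge0// !sqr_enorm /frob exchange_big.
by apply/eqP; apply: eq_bigr => i _; apply: eq_bigr => j _; rewrite !mxE.
Qed.

(** Cauchy-Schwarz entry by entry, a row of [A] against a column of [B]; no dimensional factor
    appears. *)
Lemma enorm_mulmx m n k (A : 'M[R]_(m, n)) (B : 'M[R]_(n, k)) :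
  enorm (A *m B) <= enorm A * enorm B.
Proof.
rewrite enorm_le ?mulr_ge0 ?enorm_ge0// exprMn -(enormT B) !sqr_enorm.
rewrite (frob_row A) (frob_row B^T) mulr_suml; apply: ler_sum => i _.
rewrite mulr_sumr; apply: ler_sum => j _; rewrite -!sqr_enorm -exprMn -expr2.
have -> : (A *m B) i j = frob (row i A) (row j B^T).
  by rewrite /frob big_ord1 mxE; apply: eq_bigr => l _; rewrite !mxE.
rewrite -real_normK ?num_real// ler_sqr ?nnegrE ?mulr_ge0 ?enorm_ge0//.
exact: cauchy_schwarz.
Qed.

Lemma enorm_usubmx m1 m2 n (A : 'M[R]_(m1 + m2, n)) : enorm (usubmx A) <= enorm A.
Proof.
rewrite enorm_le ?enorm_ge0// sqr_enorm [leRHS]/frob big_split_ord /=.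
rewrite -[leLHS]addr0; apply: lerD.
  by apply: ler_sum => i _; apply: ler_sum => j _; rewrite !mxE.
by apply: sumr_ge0 => i _; apply: sumr_ge0 => j _; rewrite -expr2 sqr_ge0.
Qed.

Lemma sqr_enorm_row_mx n1 n2 (u : 'rV[R]_n1) (v : 'rV[R]_n2) :
  enorm (row_mx u v) ^+ 2 = enorm u ^+ 2 + enorm v ^+ 2.
Proof.
rewrite !sqr_enorm /frob !big_ord1 big_split_ord /=; congr (_ + _);
  by apply: eq_bigr => i _; rewrite ?row_mxEl ?row_mxEr.
Qed.

Lemma enorm_row_mx_le n1 n2 (u : 'rV[R]_n1) (v : 'rV[R]_n2) :
  enorm (row_mx u v) <= enorm u + enorm v.
Proof.
rewrite -ler_sqr ?nnegrE ?addr_ge0 ?enorm_ge0// sqr_enorm_row_mx sqrrD lerD2r lerDl.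
by rewrite mulrn_wge0// mulr_ge0 ?enorm_ge0.
Qed.

End Frobenius.

(** * Taylor estimates *)

Section Taylor.
Variable R : realType.

Lemma frob_linear m n (E : 'M[R]_(m, n)) : linear_for *%R (frob E).
Proof. by move=> a A B; rewrite frobDr frobZr. Qed.

HB.instance Definition _ m n (E : 'M[R]_(m, n)) :=
  GRing.isLinear.Build R 'M[R]_(m, n) R *%R (frob E) (frob_linear E).

Lemma frob_continuous m n (E : 'M[R]_(m, n)) : continuous (frob E).
Proof.
move=> A; apply/(@cvgrPdist_lt _ _ _ _ (nbhs_filter A)) => e e0.
pose c := enorm E * (m * n)%:R + 1.
have c0 : 0 < c by rewrite ltr_wpDl// mulr_ge0 ?enorm_ge0.
have := @cvgr_dist_lt _ _ _ _ (nbhs_filter A) id A (@cvg_id _ _) _ (divr_gt0 e0 c0).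
apply: (@filterS _ _ (nbhs_filter A)) => B.
rewrite ltr_pdivlMr// -frobBr => /(le_lt_trans _); apply.
apply: (le_trans (cauchy_schwarz _ _)); rewrite mulrC.
apply: (@le_trans _ _ ((m * n)%:R * `|A - B| * enorm E)).
  by rewrite ler_wpM2r ?enorm_ge0 ?enorm_le_normr.
by rewrite mulrAC mulrC [_ * enorm E]mulrC ler_wpM2l// lerDl.
Qed.

(** The mean value theorem is scalar, so [F] is paired with its own increment [E]: the function
    [frob E (F (x + t *: v))] grows by |E|^2 over [0, 1], and Cauchy-Schwarz bounds its derivative
    by |E| B. *)
Lemma mvt_enorm l m n (F : 'rV[R]_l -> 'M[R]_(m, n)) (x v : 'rV[R]_l) (B : R) :
  (forall y, differentiable F y) ->
  (forall t, 0 <= t <= 1 -> enorm ('d F (x + t *: v) v) <= B) ->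
  enorm (F (x + v) - F x) <= B.
Proof.
move=> dF hB; set E := _ - _.
pose u (t : R) := frob E (F (x + t *: v)).
have du (t : R) : is_derive t 1 u (frob E ('d F (x + t *: v) v)).
  have h1 : is_diff t (fun s : R => x + s *: v) (fun s : R => s *: v).
    by have := is_diffD (is_diff_cst x t) (is_diff_scalel t v); rewrite add0r.
  have h2 : is_diff (x + t *: v) F ('d F (x + t *: v)) by apply: DiffDef.
  have h3 : is_diff (F (x + t *: v)) (frob E) (frob E).
    apply: DiffDef; first exact/linear_differentiable/frob_continuous.
    by rewrite diff_lin//; exact: frob_continuous.
  have h4 := is_diff_comp (is_diff_comp h1 h2) h3.
  have [h5 h6] := h4; have {}h5 : differentiable u t := h5.
  apply: DeriveDef; first exact: diff_derivable.
  rewrite deriveE//; have := congr1 (fun g : R -> R => g 1) h6.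
  by rewrite /= scale1r.
have uc : {within `[0, 1], continuous u}.
  by apply: derivable_within_continuous => t _; exact: ex_derive.
have [c c01] := MVT ltr01 (fun t _ => du t) uc.
rewrite subr0 mulr1 /u scale1r scale0r addr0 -frobBr -/E -sqr_enorm => e.
have [E0|En] := eqVneq (enorm E) 0.
  by rewrite E0; apply: (le_trans (enorm_ge0 _) (hB 0 _)); rewrite lexx ler01.
have Ep : 0 < enorm E by rewrite lt_neqAle eq_sym En enorm_ge0.
rewrite -(ler_pM2l Ep) -expr2 e; apply: (le_trans (ler_norm _)).
apply: (le_trans (cauchy_schwarz _ _)); rewrite ler_wpM2l ?enorm_ge0//.
by apply: hB; move: c01; rewrite in_itv /= => /andP[/ltW -> /ltW ->].
Qed.

(** A single real [K] turns the later estimates into inequalities between reals; for the difference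
    of two functions it will be the C^2_b norm itself. *)
Definition C2_le l m (f : 'rV[R]_l -> 'rV[R]_m) (K : R) : Prop :=
  [/\ (forall x, differentiable f x), (forall x, differentiable (jacobian f) x),
      (forall x, enorm (f x) <= K), (forall x, enorm (jacobian f x) <= K) &
      (forall x, hess_norm f x <= K)].

Section Estimates.
Variables (l m : nat) (f : 'rV[R]_l -> 'rV[R]_m) (K : R).
Hypothesis fK : C2_le f K.

Lemma C2_le_ge0 : 0 <= K.
Proof. by case: fK => _ _ /(_ 0) + _ _; exact/le_trans/enorm_ge0. Qed.

Lemma diff_jacobian x v : 'd f x v = v *m jacobian f x.
Proof. by rewrite /jacobian mul_rV_lin1. Qed.

Lemma C2_lipschitz x y : enorm (f y - f x) <= K * enorm (y - x).
Proof.
rewrite -{1}(subrKC x y); case: fK => df _ _ Kf _; apply: mvt_enorm => // t _.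
rewrite diff_jacobian; apply: (le_trans (enorm_mulmx _ _)).
by rewrite mulrC ler_wpM2r ?enorm_ge0.
Qed.

Lemma enorm_diff_jacobian x v : enorm ('d (jacobian f) x v) <= K * enorm v.
Proof.
have [_ dJ _ _ Kh] := fK.
apply: (@le_trans _ _ (hess_norm f x * enorm v)); last by rewrite ler_wpM2r ?enorm_ge0.
rewrite {1}(row_sum_delta v) linear_sum /=.
apply: (@le_trans _ _ (\sum_(k < l) `|v 0 k| * enorm ('d (jacobian f) x (delta_mx 0 k)))).
  elim/big_rec2: _ => [|k y z _ h]; first by rewrite enorm0.
  by apply: (le_trans (ler_enormD _ _)); apply: lerD => //; rewrite linearZ enormZ.
(* The Hessian norm is the Euclidean norm of the vector [b], so the sum is an inner product to which
   Cauchy-Schwarz applies. *)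
pose a : 'rV[R]_l := \row_k `|v 0 k|.
pose b : 'rV[R]_l := \row_k enorm ('d (jacobian f) x (delta_mx 0 k)).
have -> : \sum_(k < l) `|v 0 k| * enorm ('d (jacobian f) x (delta_mx 0 k)) = frob b a.
  by rewrite /frob big_ord1; apply: eq_bigr => k _; rewrite !mxE mulrC.
apply: (le_trans (ler_norm _)); apply: (le_trans (cauchy_schwarz _ _)).
have -> : enorm a = enorm v.
  rewrite /enorm !big_ord1; congr Num.sqrt; apply: eq_bigr => k _.
  by rewrite mxE real_normK ?num_real.
suff -> : enorm b = hess_norm f x by [].
rewrite /enorm big_ord1; congr Num.sqrt; apply: eq_bigr => k _.
by rewrite mxE.
Qed.

Lemma C2_jacobian_lipschitz x y :
  enorm (jacobian f y - jacobian f x) <= K * enorm (y - x).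
Proof.
rewrite -{1}(subrKC x y); case: fK => _ dJ _ _ _; apply: mvt_enorm => // t _.
exact: enorm_diff_jacobian.
Qed.

(** Subtracting the differential at [x], frozen as a linear map, leaves a function whose derivative
    along the segment is small by the Lipschitz bound on the Jacobian. The mean value bound then
    gives the square, with [K] instead of K / 2. *)
Lemma C2_taylor x y :
  enorm (f y - f x - (y - x) *m jacobian f x) <= K * enorm (y - x) ^+ 2.
Proof.
set v := y - x; have [df dJ _ _ _] := fK.
pose L : {linear 'rV[R]_l -> 'rV[R]_m} := 'd f x.
have Lc : continuous L by exact: diff_continuous.
have LE u : L u = u *m jacobian f x by exact: diff_jacobian.
move: L Lc LE => L Lc LE.
have dL z : is_diff z L L.
  by apply: DiffDef; [exact: linear_differentiable|rewrite diff_lin].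
pose g : 'rV[R]_l -> 'rV[R]_m := f - (L : 'rV[R]_l -> 'rV[R]_m).
have dg z : is_diff z g (('d f z : 'rV[R]_l -> 'rV[R]_m) - (L : 'rV[R]_l -> 'rV[R]_m)).
  by apply: is_diffB; apply: DiffDef.
have -> : f y - f x - v *m jacobian f x = g (x + v) - g x.
  rewrite /g !fctE linearD /= subrKC -LE opprB opprD -[RHS]addrA.
  by rewrite [X in _ = _ + X]addrACA addNr add0r addrA addrAC.
apply: mvt_enorm => [z|t /andP[t0 t1]]; first by case: (dg z).
have [_ ->] := dg (x + t *: v); rewrite !fctE LE diff_jacobian -mulmxBr.
apply: (le_trans (enorm_mulmx _ _)); rewrite mulrC.
rewrite expr2 mulrA ler_wpM2r ?enorm_ge0//.
apply: (le_trans (C2_jacobian_lipschitz _ _)); rewrite addrAC subrr add0r.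
rewrite ler_wpM2l ?C2_le_ge0// enormZ ger0_norm//.
by rewrite -[leRHS]mul1r ler_wpM2r ?enorm_ge0.
Qed.
End Estimates.
End Taylor.

(** * Points of partitions *)

Section PartitionPoints.
Variable R : realType.
Implicit Types (P X : set R) (x y t u v : R).

Lemma finite_has_max X : finite_set X -> X !=set0 ->
  exists2 m, X m & forall a, X a -> a <= m.
Proof.
move=> /finite_seqP[s ->] [x0 /= x0s].
elim: s x0 x0s => [//|a s ih] x0 _.
case: s ih => [|b s] ih; first by exists a; rewrite /= ?inE// => c; rewrite inE => /eqP ->.
have [m ms hm] := ih b (mem_head _ _).
exists (Num.max a m); last first.
  by move=> c /=; rewrite inE le_max => /orP[/eqP->|/hm ->]; rewrite ?lexx ?orbT.
by rewrite /= inE; case: (leP a m) => _; rewrite ?eqxx // ms orbT.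
Qed.

Lemma finite_has_min X : finite_set X -> X !=set0 ->
  exists2 m, X m & forall a, X a -> m <= a.
Proof.
move=> fX [x0 Xx0].
have [| |m [a Xa <-] hm] := @finite_has_max [set - a | a in X].
- exact: finite_image.
- by exists (- x0), x0.
exists a => // b Xb; rewrite -lerN2; apply: hm; by exists b.
Qed.

(** Local finiteness in the form that yields consecutive points; it covers the partitions of the
    half-line as well as the restricted ones. *)
Definition finite_upto P y :=
  exists b, [/\ P b, y <= b & finite_set (P `&` [set a | a <= b])].

Lemma next_point P x y : finite_upto P y -> x < y ->
  exists v, [/\ P v, x < v & forall a, P a -> ~ (x < a < v)].
Proof.
move=> [b [Pb yb fP]] xy.
have xb : x < b := lt_le_trans xy yb.
have [| |v [[Pv vb] /= xv] hv] := @finite_has_min ((P `&` [set a | a <= b]) `&` [set a | x < a]).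
- exact: finite_setIl.
- by exists b; split => //; split => //=.
exists v; split=> // a Pa /andP[xa av]; have ab : a <= b := le_trans (ltW av) vb.
by have : v <= a; [exact: hv|rewrite leNgt av].
Qed.

Lemma subitvs_unique P u v v' : subitvs P (u, v) -> subitvs P (u, v') -> v = v'.
Proof.
move=> [/= _ Pv uv h] [/= _ Pv' uv' h']; apply/le_anti/andP; split; rewrite leNgt; apply/negP => lt.
  by apply: (h v' Pv'); rewrite uv'.
by apply: (h' v Pv); rewrite uv.
Qed.

Lemma covering_subitv P x y a : finite_upto P y -> P a -> a <= x -> x < y ->
  exists uv, [/\ subitvs P uv, uv.1 <= x & x < uv.2].
Proof.
move=> [b [Pb yb fP]] Pa ax xy.
have xb : x <= b := le_trans (ltW xy) yb.
have [| |u [[Pu ub] /= ux] hu] := @finite_has_max ((P `&` [set a | a <= b]) `&` [set a | a <= x]).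
- exact: finite_setIl.
- by exists a; split => //; split => //=; exact: le_trans xb.
have [v [Pv xv hv]] := next_point (ex_intro _ b (And3 Pb yb fP)) xy.
exists (u, v); split => //; split => //=; first exact: le_lt_trans xv.
move=> c Pc /andP[uc cv]; have [cx|xc] := leP c x; last by apply: (hv c) => //; rewrite xc.
have : c <= u by apply: hu; split => //; split => //=; exact: le_trans xb.
by rewrite leNgt uc.
Qed.

Section Increments.
Variables (V : zmodType) (P : set R) (h : R -> R -> V).

(** The common shape of [discr_capital] and [discr_int]: [h u r] pairs the integrand frozen at [u]
    with the value [S r]. *)
Definition partition_sum t : V :=
  \sum_(uv \in subitvs P) (h uv.1 (Num.min uv.2 t) - h uv.1 (Num.min uv.1 t)).

Lemma partition_sum_incr x y : finite_upto P y -> P x -> x < y ->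
  (forall a, P a -> ~ (x < a < y)) ->
  partition_sum y - partition_sum x = h x y - h x x.
Proof.
move=> fy Px xy nP.
(* [y] may be a stopping time strictly inside the partition interval [(x, w)]. *)
have [w [Pw xw nw]] := next_point fy xy.
have sxw : subitvs P (x, w) by [].
have yw : y <= w by rewrite leNgt; apply/negP => wy; apply: (nP w Pw); rewrite xw.
pose Z := subitvs P `&` [set uv | uv.1 < y].
have fZ : finite_set Z.
  have [b [Pb yb fP]] := fy.
  apply: sub_finite_set (finite_setX fP fP) => -[u v] [[/= Pu Pv uv nuv] uy].
  split; split => //=; first exact: ltW (lt_le_trans uy yb).
  by rewrite leNgt; apply/negP => bv; apply: (nuv b Pb); rewrite (lt_le_trans uy yb).
have DZ r : r <= y -> partition_sum r =
    \sum_(uv \in Z) (h uv.1 (Num.min uv.2 r) - h uv.1 (Num.min uv.1 r)).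
  move=> ry; rewrite /partition_sum; apply/esym/fsbig_widen; first by move=> ? [].
  move=> [u v] [suv nZ]; have [/= Pu Pv uv nuv] := suv.
  have yu : y <= u by rewrite leNgt; apply/negP => uy; apply: nZ.
  rewrite !min_r ?subrr// ?(le_trans ry)//; exact: le_trans yu (ltW uv).
rewrite !DZ ?(ltW xy)//; apply/eqP; rewrite subr_eq addrC; apply/eqP.
(* Between the times [x] and [y] only the interval [(x, w)] contributes: the others in [Z] are over
   by time [x], and those starting at [y] or later are not in [Z]. *)
pose D (uv : R * R) := h uv.1 (Num.min uv.2 y) - h uv.1 (Num.min uv.1 y) -
  (h uv.1 (Num.min uv.2 x) - h uv.1 (Num.min uv.1 x)).
transitivity (\sum_(uv \in Z) (h uv.1 (Num.min uv.2 x) - h uv.1 (Num.min uv.1 x) + D uv)).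
  by apply: eq_fsbigr => uv _; rewrite /D subrKC.
rewrite fsbig_split//; congr (_ + _).
transitivity (\sum_(uv \in [set (x, w)]) D uv).
  apply/esym/fsbig_widen => [_ ->//|[u v] [[suv /= uy] /= ne]].
  have [/= Pu Pv uv nuv] := suv.
  have ux : u < x.
    rewrite ltNge le_eqVlt; apply/negP => /orP[/eqP e|xu].
      by apply: ne; rewrite -e in suv *; rewrite (subitvs_unique suv sxw).
    by apply: (nP u Pu); rewrite xu.
  have vx : v <= x by rewrite leNgt; apply/negP => xv; apply: (nuv x Px); rewrite ux.
  by rewrite /D /= !min_l ?subrr// ltW// ?(lt_trans ux)// (le_lt_trans vx).
rewrite fsbig_set1 /D /= (min_r yw) (min_l (ltW xy)) (min_r (ltW xw)) minxx.
by rewrite subrr subr0.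
Qed.

Lemma partition_sum0 : P `<=` `[0, +oo[ -> partition_sum 0 = 0.
Proof.
move=> P0; apply: fsbig1 => -[u v] [/= Pu Pv _ _].
have := P0 _ Pu; have := P0 _ Pv; rewrite /= !in_itv /= !andbT => v0 u0.
by rewrite !min_r ?subrr.
Qed.

End Increments.

(* Meant for X containing 0 as its least point, which is dropped. *)
Definition pts X : seq R := behead (sort <=%O (fset_set X)).

Lemma pts_spec X t : finite_set X -> X `<=` `[0, t] -> X 0 -> X t ->
  [/\ path <%R 0 (pts X), last 0 (pts X) = t &
      forall a, (a \in 0 :: pts X) <-> X a].
Proof.
move=> fX X0t X0 Xt.
have memE a : (a \in sort <=%O (fset_set X)) <-> X a.
  by rewrite mem_sort in_fset_set//; split=> [/set_mem|/mem_set].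
have srt : sorted <%R (sort <=%O (fset_set X)).
  by rewrite lt_sorted_uniq_le sort_uniq fset_uniq sort_le_sorted.
have e : sort <=%O (fset_set X) = 0 :: pts X.
  rewrite /pts; move/memE: (X0).
  case E : (sort _ _) srt memE => [//|b s] srt memE; rewrite inE => /orP[/eqP<-//|].
  move=> /(allP (order_path_min lt_trans srt)) b0.
  have := X0t b (proj1 (memE b) (mem_head _ _)).
  by rewrite /= in_itv /= leNgt b0.
rewrite e in srt memE; split => //.
apply/le_anti/andP; split.
  by have := X0t _ (proj1 (memE _) (mem_last 0 _)); rewrite /= in_itv => /andP[].
by apply: path_le_last => //; apply/memE.
Qed.

(** As a function of its stopping time, [partition_sum] telescopes along [X]. Agreement of [X] with
    [P] is asked only before [t], because [t] itself need not belong to [P]. *)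
Lemma partition_sum_pts (V : zmodType) P X t (h : R -> R -> V) :
  finite_set X -> X `<=` `[0, t] -> X 0 -> X t -> finite_upto P t ->
  P `<=` `[0, +oo[ -> (forall a, 0 <= a -> a < t -> X a <-> P a) ->
  partition_sum P h t = psum (fun u v => h u v - h u u) 0 (pts X).
Proof.
move=> fX X0t X0 Xt fP P0 XP.
have [ps lp mp] := pts_spec fX X0t X0 Xt.
rewrite -[LHS]subr0 -{1}lp -(partition_sum0 h P0).
rewrite -(psum_telescope (partition_sum P h)); apply: eq_psum_consecutive.
move=> s1 u v s2 e; have [um vm uv huv] := path_consecutive ps e.
have vt : v <= t by rewrite -lp; apply: path_le_last => //; rewrite inE vm orbT.
have u0 : 0 <= u by apply: path_ge_head ps um.
have Pu : P u by apply/(XP u) => //; [exact: lt_le_trans vt|apply/mp].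
apply: partition_sum_incr => //.
  by have [b [Pb tb fb]] := fP; exists b; split => //; exact: le_trans tb.
move=> a Pa /andP[ua av].
have : X a by apply/(XP a) => //; [exact: le_trans (ltW ua)|exact: lt_le_trans vt].
by move/mp/huv => []; rewrite leNgt ?ua ?av.
Qed.

Lemma restr_partition_fin P t : 0 <= t -> finite_set (P `&` `[0, t]) ->
  [/\ finite_set (restr_partition P t), restr_partition P t `<=` `[0, t],
      restr_partition P t 0 & restr_partition P t t].
Proof.
move=> t0 fP; split.
- rewrite /restr_partition setIUl finite_setU; split => //.
  by apply: finite_setIl.
- by move=> ? [].
- by split; [right; left|rewrite /= in_itv /= lexx t0].
- by split; [right; right|rewrite /= in_itv /= lexx t0].
Qed.

End PartitionPoints.

(** * Consequences of (RIE) and oscillation on partition intervals *)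

Section Unpacking.
Variable R : realType.
Implicit Types (P : nat -> set R) (T p : R).

Lemma uniform_enorm m n (D : set R) (F : nat -> R -> 'M[R]_(m, n)) f :
  {uniform D, F @ \oo --> f} -> forall e : R, 0 < e ->
  exists N, forall k, (N <= k)%N -> forall x, D x -> enorm (F k x - f x) <= e.
Proof.
move=> Ff e e0; pose c : R := (m * n)%:R + 1.
have c0 : 0 < c by rewrite ltr_wpDl.
have := Ff [set h | forall y, D y -> ball (f y) (e / c) (h y)] _.
case; last first.
  move=> N _ hN; exists N => k Nk x Dx; have := hN k Nk x Dx.
  rewrite -ball_normE /= ltr_pdivlMr// enormBC => /ltW h.
  apply: (le_trans (enorm_le_normr _)); apply: le_trans h.
  by rewrite mulrC ler_wpM2l// lerDl.
apply/uniform_nbhs; exists [set xy | ball xy.1 (e / c) xy.2]; split => //.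
by have := @entourage_ball R 'M[R]_(m, n) (PosNum (divr_gt0 e0 c0)).
Qed.

Lemma eratio_ge0 (x y : R) : 0 <= x -> 0 <= y -> (0 <= eratio x y)%E.
Proof.
by move=> x0 y0; rewrite /eratio mule_ge0// ?inve_ge0// lee_fin.
Qed.

Lemma eratio_le1 (x y : R) : 0 <= x -> 0 <= y -> (eratio x y <= 1)%E -> x <= y.
Proof.
move=> x0 y0; have [->|yn] := eqVneq y 0; last first.
  have yp : 0 < y by rewrite lt_neqAle eq_sym yn.
  by rewrite /eratio inver (negbTE yn) -EFinM lee_fin ler_pdivrMr// mul1r.
(* Zero denominator: a positive numerator would make the ratio +oo. *)
rewrite le_eqVlt eq_sym in x0; case/orP: x0 => [/eqP->//|x0].
by rewrite /eratio inver eqxx gt0_muley ?lte_fin.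
Qed.

(** Both suprema are nonnegative and their sum is at most 1, so each is at most 1 and the quotients
    can be cleared. *)
Lemma RIE_control d T p P (S : R -> 'rV[R]_d) : 0 < T -> RIE T p P S ->
  exists w, [/\ control T w,
    forall s t, 0 <= s -> s <= t -> t <= T -> enorm (incr S s t) `^ p <= w s t &
    forall n s t, P n s -> P n t -> s < t ->
      enorm (discr_int (P n) S t - discr_int (P n) S s - tens (S s) (incr S s t))
        `^ (p / 2) <= w s t].
Proof.
move=> T0 [[finP _ _] _ _ [w cw]]; have [w0 _] := cw.
set X1 := ereal_sup _; set X2 := ereal_sup _ => X12.
have inT n s : P n s -> 0 <= s <= T.
  by move=> Ps; have [_ /(_ _ Ps)] := finP n; rewrite /= in_itv.
have ge1 s t : 0 <= s -> s <= t -> t <= T ->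
    (eratio (enorm (incr S s t) `^ p) (w s t) <= X1)%E.
  by move=> s0 st tT; apply: ereal_sup_ubound; exists (s, t) => //=; rewrite s0 st.
have ge2 n s t : P n s -> P n t -> s < t ->
    (eratio (enorm (discr_int (P n) S t - discr_int (P n) S s -
       tens (S s) (incr S s t)) `^ (p / 2)) (w s t) <= X2)%E.
  by move=> Ps Pt st; apply: ereal_sup_ubound; exists n, s, t.
have X1p : (0 <= X1)%E.
  apply: le_trans (ge1 0 0 _ _ _) => //; last exact: ltW.
  by apply: eratio_ge0; rewrite ?powR_ge0 ?w0// ltW.
have X2p : (0 <= X2)%E.
  have [_ _ P0 PT] := finP 0%N.
  apply: le_trans (ge2 0%N 0 T P0 PT T0).
  by apply: eratio_ge0; rewrite ?powR_ge0 ?w0// ltW.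
exists w; split => // [s t s0 st tT|n s t Ps Pt st].
  apply: eratio_le1; rewrite ?powR_ge0 ?w0//.
  by apply: (le_trans (ge1 _ _ s0 st tT)); apply: le_trans X12; rewrite leeDl.
have /andP[s0 _] := inT _ _ Ps; have /andP[_ tT] := inT _ _ Pt.
apply: eratio_le1; rewrite ?powR_ge0 ?(w0 _ _ s0 (ltW st) tT)//.
by apply: (le_trans (ge2 _ _ _ Ps Pt st)); apply: le_trans X12; rewrite leeDr.
Qed.

(** [rie_int] is by definition a pointwise limit; it is identified with the uniform limit provided
    by (RIE). *)
Lemma rie_int_cvg d T p P (S : R -> 'rV[R]_d) : RIE T p P S ->
  forall e : R, 0 < e -> exists N, forall k, (N <= k)%N -> forall t, 0 <= t <= T ->
    enorm (discr_int (P k) S t - rie_int P S t) <= e.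
Proof.
move=> [_ _ [I cI] _] e e0.
have h := uniform_enorm cI.
have II t : 0 <= t <= T -> rie_int P S t = I t.
  move=> tT; apply/cvg_lim => //; apply/cvgrPdist_le => eps eps0.
  have [N hN] := h _ eps0; exists N => // k Nk; rewrite distrC.
  by apply: (le_trans (normr_le_enorm _)); apply: hN; rewrite //= in_itv.
have [N hN] := h _ e0; exists N => k Nk t tT; rewrite II//.
by apply: hN; rewrite //= in_itv.
Qed.

Lemma discretizedE d (X : set R) T (S : R -> 'rV[R]_d) u v x :
  subitvs X (u, v) -> u <= x -> x < v -> x != T -> discretized X T S x = S u.
Proof.
move=> suv ux xv xT; rewrite /discretized indicE memNset ?scale0r ?add0r; last first.
  by move=> /= e; rewrite e eqxx in xT.
transitivity (\sum_(uv \in [set (u, v)])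
   (\1_(`[uv.1, uv.2[%classic) x *: S uv.1 : 'rV[R]_d)).
  apply/esym/fsbig_widen => [_ -> //|[a b] [[/= Xa Xb ab nab] /= ne]].
  have [/= Xu Xv uv nuv] := suv.
  rewrite indicE memNset ?scale0r//= in_itv /= => /andP[ax xb]; apply: ne.
  have -> : a = u.
    apply/le_anti/andP; split; rewrite leNgt; apply/negP => h.
      by apply: (nuv a Xa); rewrite h (le_lt_trans ax).
    by apply: (nab u Xu); rewrite h (le_lt_trans ux).
  congr (_, _); apply/le_anti/andP; split; rewrite leNgt; apply/negP => h.
    by apply: (nab v Xv); rewrite h (le_lt_trans ax).
  by apply: (nuv b Xb); rewrite h (le_lt_trans ux).
rewrite fsbig_set1 indicE mem_set ?scale1r//=.
by rewrite in_itv /= ux.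
Qed.

(** The discretised path is constantly [S u] on [[u, v[], so its uniform convergence is a bound on
    the oscillation there. *)
Lemma RIE_oscillation d T p P (S : R -> 'rV[R]_d) : RIE T p P S ->
  forall e : R, 0 < e -> exists N, forall k, (N <= k)%N ->
  forall u v x, subitvs (P k) (u, v) -> u <= x -> x < v -> enorm (S x - S u) <= e.
Proof.
move=> [[finP _ _] /uniform_enorm Su _ _] e e0.
have [N hN] := Su _ e0; exists N => k Nk u v x suv ux xv.
have [/= Pu Pv uv _] := suv; have [_ sub _ _] := finP k.
have := sub _ Pu; have := sub _ Pv; rewrite /= !in_itv /= => /andP[v0 vT] /andP[u0 uT].
have xT : x < T := lt_le_trans xv vT.
have := hN k Nk x; rewrite (discretizedE _ suv)// ?lt_eqF// enormBC; apply.
by rewrite /= in_itv /= (le_trans u0)//= ltW.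
Qed.

End Unpacking.

(** * Cadlag paths whose jump times lie in the partitions *)

Section Oscillation.
Variables (R : realType) (V : normedModType R).
Implicit Types (D : set R) (f : R -> V) (P : nat -> set R).

Lemma cadlag_osc D f t : cadlag D f -> D t ->
  exists l : V, forall e : R, 0 < e -> exists2 r : R, 0 < r &
    (forall x, D x -> `|x - t| < r -> x < t -> `|l - f x| < e) /\
    (forall x, D x -> `|x - t| < r -> t <= x -> `|f t - f x| < e).
Proof.
move=> cf Dt; have [fr /cvg_ex[l fl]] := cf t Dt; exists l => e e0.
have /cvgrPdist_lt/(_ e e0) /= hr := fr.
have /cvgrPdist_lt/(_ e e0) /= hl := fl.
have /nbhs_ballP[r1 /= r10 hr1] := hr.
have /nbhs_ballP[r2 /= r20 hr2] := hl.
exists (Num.min r1 r2); first by rewrite lt_min r10.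
split=> x Dx; rewrite lt_min => /andP[xr1 xr2].
  by move=> xt; apply: hr2 => //; rewrite /ball /= distrC.
rewrite le_eqVlt => /orP[/eqP<-|tx]; first by rewrite subrr normr0.
by apply: hr1 => //; rewrite /ball /= distrC.
Qed.

Lemma left_cvg f t l : 0 < t ->
  (forall e : R, 0 < e -> exists2 r : R, 0 < r &
    forall x, 0 <= x -> `|x - t| < r -> x < t -> `|l - f x| < e) ->
  f x @[x --> t^'-] --> l.
Proof.
move=> t0 h; apply/cvgrPdist_lt => e /h[r r0 hr].
apply/nbhs_ballP; exists (Num.min r t); first by rewrite /= lt_min r0.
move=> x; rewrite /ball /= lt_min => /andP[xr xt0] xt.
apply: hr => //; last by rewrite distrC.
move: xt0; rewrite ltr_norml => /andP[_]; lra.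
Qed.

Lemma mesh_le (T : R) (X : set R) u v : X `<=` `[0, T] -> subitvs X (u, v) -> v - u <= mesh X.
Proof.
move=> XT suv; apply: ub_le_sup; last by exists (u, v).
exists T => _ [[a b] [/= Xa Xb _ _] <-] /=.
have := XT _ Xa; have := XT _ Xb; rewrite /= !in_itv /=; lra.
Qed.

(* A jump outside of all partitions is impossible, and a jump at a partition
   point never lies inside a subinterval; compactness does the rest. *)
Lemma cadlag_oscillation P f T : 0 < T -> cadlag `[0, +oo[ f ->
  jump_times f `<=` \bigcup_n P n -> nested P ->
  mesh (restr_partition (P n) T) @[n --> \oo] --> (0 : R) ->
  forall e : R, 0 < e -> exists N, forall k, (N <= k)%N ->
  forall u v x, subitvs (restr_partition (P k) T) (u, v) -> u <= x -> x < v ->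
    `|f x - f u| <= e.
Proof.
move=> T0 cf jf nP mP e e0.
have e20 : 0 < e / 2 by rewrite divr_gt0.
pose Q k u := forall v x, subitvs (restr_partition (P k) T) (u, v) -> u <= x ->
  x < v -> `|f x - f u| <= e.
have subT k : restr_partition (P k) T `<=` `[0, T] by move=> ? [].
suff [N _ hN] : \forall k \near \oo, `[0, T]%classic `<=` Q k.
  exists N => k Nk u v x suv; apply: (hN k Nk _ _ v x suv).
  by apply: (subT k); case: suv.
have /compact_near_coveringP := @segment_compact R 0 T; apply => t /=.
rewrite in_itv /= => /andP[t0 tT].
have Dt : `[0, +oo[%classic t by rewrite /= in_itv /= t0.
have [l hl] := cadlag_osc cf Dt.
have [r r0 [lr rr]] := hl _ e20.
have r20 : 0 < r / 2 by rewrite divr_gt0.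
have /cvgrPdist_lt/(_ _ r20)[N1 _ mN1] := mP.
(* Eventually no partition interval has a jump at [t] in its interior: a jump time belongs to some
   [P n], hence to all finer partitions. If [t] is no jump time, the left limit [l] is [f t]; at the
   ends of [[0, T]] the claim is void. *)
have [N2 hN2] : exists N2, forall k u v, (N2 <= k)%N ->
    subitvs (restr_partition (P k) T) (u, v) -> u < t -> t < v -> f t = l.
  have [tt|tT'] := ltP t T; last first.
    exists 0%N => k u v _ [/= _ Rv _ _] _ tv.
    have := subT k _ Rv; rewrite /= in_itv /= => /andP[_].
    by rewrite leNgt (le_lt_trans tT' tv).
  have [tp|t0'] := ltP 0 t; last first.
    exists 0%N => k u v _ [/= Ru _ _ _] ut _.
    have := subT k _ Ru; rewrite /= in_itv /= => /andP[+ _].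
    by rewrite leNgt (lt_le_trans ut t0').
  have [jt|/not_andP[//|/negP]] := pselect (jump_times f t); last first.
    rewrite negbK subr_eq0 => /eqP ->; exists 0%N => *.
    apply: cvg_lim => //; apply: left_cvg => // e' e'0; have [r' r'0 [hr' _]] := hl _ e'0.
    by exists r' => // x x0; apply: hr'; rewrite /= in_itv /= x0.
  have [n _ Pn] := jf _ jt.
  exists n => k u v nk [/= _ _ _ h] ut tv; exfalso; apply: (h t); last by rewrite ut.
  split; last by rewrite /= in_itv /= t0.
  by left; elim: k nk {h} => [|k ih]; rewrite ?leqn0 => nk;
    [rewrite (eqP nk) in Pn|move: nk; rewrite leq_eqVlt => /orP[/eqP<-//|/ih/nP]].
(* Half of [r] for the distance from [u] to [t], half for the mesh: then [x] is also within [r] of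
   [t]. *)
exists ([set x | `|x - t| < r / 2], [set k | (maxn N1 N2 <= k)%N]); first split => /=.
- apply/nbhs_ballP; exists (r / 2) => //= y; rewrite /ball /= distrC.
  by [].
- by exists (maxn N1 N2).
move=> [u k] [/= utr]; rewrite geq_max => /andP[N1k N2k] v x suv ux xv.
have [/= Ru Rv _ _] := suv.
have := subT k _ Ru; rewrite /= in_itv /= => /andP[u0 _].
have vur : v - u < r / 2.
  apply: le_lt_trans (mesh_le (@subT k) suv) _.
  by have := mN1 k N1k; rewrite sub0r normrN => /(le_lt_trans (ler_norm _)).
have utr' : `|u - t| < r by apply: lt_trans utr _; lra.
have xtr' : `|x - t| < r.
  by move: utr; rewrite !ltr_norml => /andP[h1 h2]; apply/andP; split; lra.
have Du : `[0, +oo[%classic u by rewrite /= in_itv /= u0.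
have Dx : `[0, +oo[%classic x by rewrite /= in_itv /= (le_trans u0 ux).
have tri (a : V) : `|a - f u| < e / 2 -> `|a - f x| < e / 2 -> `|f x - f u| <= e.
  move=> h1 h2; rewrite -(subrKA a) [leRHS]splitr.
  by apply: (le_trans (ler_normD _ _)); rewrite distrC lerD// ltW.
(* If [u] and [x] are on the same side of [t], one one-sided limit serves both; if they straddle
   [t], the two limits agree by [hN2]. *)
have [tu|ut] := leP t u.
  by apply: (tri (f t)); apply: rr => //; exact: le_trans tu ux.
have [tx|xt] := leP t x; last by apply: (tri l); apply: lr.
have e1 := hN2 k u v N2k suv ut (le_lt_trans tx xv).
by apply: (tri (f t)); [rewrite e1; apply: lr|apply: rr].
Qed.

End Oscillation.

(** * The germ *)

Section Germ.
Variables (R : realType) (d dA : nat).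
Variables (S : R -> 'rV[R]_d) (A : R -> 'rV[R]_dA).
Variables (g : 'rV[R]_(d + dA) -> 'rV[R]_d) (K : R).

Definition strategy t : 'rV[R]_d := g (row_mx (S t) (A t)).
(** The Gubinelli derivative: since matrices act on rows, the partial Jacobian in the variable [S]
    consists of the first [d] rows. *)
Definition strategy' t : 'M[R]_d := usubmx (jacobian g (row_mx (S t) (A t))).

(** [J] is a parameter so that the discrete integrals and their limit share the same algebra; for
    the limit this is [rie_area]. *)
Definition area_of (J : R -> 'M[R]_d) s t : 'M[R]_d :=
  J t - J s - tens (S s) (S t - S s).

Definition germ (J : R -> 'M[R]_d) s t : R :=
  frob (strategy s) (S t - S s) + frob (strategy' s) (area_of J s t).

Lemma frob_tens (M : 'M[R]_d) (a b : 'rV[R]_d) : frob M (tens a b) = frob (a *m M) b.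
Proof.
rewrite /frob big_ord1 exchange_big; apply: eq_bigr => j _.
rewrite [in RHS]mxE mulr_suml; apply: eq_bigr => i _.
by rewrite /tens mxE big_ord1 mxE mulrCA mulrA.
Qed.

Lemma enorm_tens (a b : 'rV[R]_d) : enorm (tens a b) <= enorm a * enorm b.
Proof. by rewrite /tens -(enormT a) enorm_mulmx. Qed.

Lemma tensBr (a b c : 'rV[R]_d) : tens a (b - c) = tens a b - tens a c.
Proof. by rewrite /tens mulmxBr. Qed.

Lemma tensBl (a b c : 'rV[R]_d) : tens (a - b) c = tens a c - tens b c.
Proof. by rewrite /tens raddfB mulmxBl. Qed.

Lemma area_chen J x y z :
  area_of J x z = area_of J x y + area_of J y z + tens (S y - S x) (S z - S y).
Proof.
rewrite /area_of tensBl !tensBr !opprB; apply/matrixP => i j; rewrite !mxE; ring.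
Qed.

(** The tensor in Chen's relation [area_chen], paired with [strategy' x], turns the increment of the
    strategy into its controlled remainder. *)
Lemma germ_delta J x y z : germ J x y + germ J y z - germ J x z =
  frob (strategy y - strategy x - (S y - S x) *m strategy' x) (S z - S y) +
  frob (strategy' y - strategy' x) (area_of J y z).
Proof.
rewrite /germ (area_chen J x y z).
move: strategy strategy' (area_of J x y) (area_of J y z) => f f' a b.
rewrite !frobDr frob_tens !frobBl !frobDr !frobNr.
move: (frob (f x) (S x)) (frob (f x) (S y)) (frob (f x) (S z)) => c1 c2 c3.
move: (frob (f y) (S y)) (frob (f y) (S z)) => c4 c5.
move: (frob (f' x) a) (frob (f' x) b) (frob (f' y) b) => c6 c7 c8.
move: (frob (_ *m _) (S z)) (frob (_ *m _) (S y)) => c9 c10; ring.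
Qed.

Hypothesis gK : C2_le g K.

Lemma enorm_strategy t : enorm (strategy t) <= K.
Proof. by case: gK => _ _ h _ _; exact: h. Qed.

Lemma enorm_strategy' t : enorm (strategy' t) <= K.
Proof. by case: gK => _ _ _ h _; apply: (le_trans (enorm_usubmx _)). Qed.

Lemma enorm_row_incr s t : enorm (row_mx (S t) (A t) - row_mx (S s) (A s)) <=
  enorm (S t - S s) + enorm (A t - A s).
Proof. by rewrite opp_row_mx add_row_mx enorm_row_mx_le. Qed.

Lemma strategy_lipschitz s t : enorm (strategy t - strategy s) <=
  K * (enorm (S t - S s) + enorm (A t - A s)).
Proof.
apply: (le_trans (C2_lipschitz gK _ _)).
by rewrite ler_wpM2l ?(C2_le_ge0 gK) ?enorm_row_incr.
Qed.

Lemma strategy'_lipschitz s t : enorm (strategy' t - strategy' s) <=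
  K * (enorm (S t - S s) + enorm (A t - A s)).
Proof.
rewrite /strategy' -raddfB; apply: (le_trans (enorm_usubmx _)).
apply: (le_trans (C2_jacobian_lipschitz gK _ _)).
by rewrite ler_wpM2l ?(C2_le_ge0 gK) ?enorm_row_incr.
Qed.

Lemma enorm_remainder s t :
  enorm (strategy t - strategy s - (S t - S s) *m strategy' s) <=
  K * (enorm (S t - S s) ^+ 2 + enorm (A t - A s)).
Proof.
(* Intermediate point: from it to time [t] only [A] moves, at a cost of first order; from time [s]
   to it only [S] moves, and Taylor's formula gives the square. *)
set G := g (row_mx (S t) (A s)).
have -> : strategy t - strategy s - (S t - S s) *m strategy' s =
    (strategy t - G) + (G - strategy s - (S t - S s) *m strategy' s).
  by rewrite !addrA subrK.
rewrite mulrDr [leRHS]addrC.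
apply: (le_trans (ler_enormD _ _)); apply: lerD; last first.
  have := C2_taylor gK (row_mx (S s) (A s)) (row_mx (S t) (A s)).
  have -> : row_mx (S t) (A s) - row_mx (S s) (A s) = row_mx (S t - S s) 0.
    by rewrite opp_row_mx add_row_mx subrr.
  rewrite -[X in row_mx _ _ *m X]vsubmxK mul_row_col mul0mx addr0.
  by rewrite sqr_enorm_row_mx enorm0 expr0n /= addr0.
apply: (le_trans (C2_lipschitz gK _ _)); rewrite ler_wpM2l ?(C2_le_ge0 gK)//.
rewrite opp_row_mx add_row_mx subrr.
by apply: (le_trans (enorm_row_mx_le _ _)); rewrite enorm0 add0r.
Qed.

Lemma germ_bound J s t : `|germ J s t| <= K * enorm (S t - S s) + K * enorm (area_of J s t).
Proof.
apply: (le_trans (ler_normD _ _)); apply: lerD;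
  apply: (le_trans (cauchy_schwarz _ _)); rewrite ler_wpM2r ?enorm_ge0//.
- exact: enorm_strategy.
- exact: enorm_strategy'.
Qed.

Lemma germ_delta_le J x y z : `|germ J x y + germ J y z - germ J x z| <=
  K * (enorm (S y - S x) ^+ 2 + enorm (A y - A x)) * enorm (S z - S y) +
  K * (enorm (S y - S x) + enorm (A y - A x)) * enorm (area_of J y z).
Proof.
rewrite germ_delta; apply: (le_trans (ler_normD _ _)); apply: lerD;
  apply: (le_trans (cauchy_schwarz _ _)); rewrite ler_wpM2r ?enorm_ge0//.
- exact: enorm_remainder.
- exact: strategy'_lipschitz.
Qed.

(** Scaling: [S] has order [e] and the area order [e ^+ 2], so the defect has order [e ^+ 3]. The
    increment of [A] is needed at order [e ^+ 2] where it meets [S], and at order [e] where it meets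
    the area. *)
Lemma germ_delta_scale J x y z (sg al ar e : R) : 0 <= sg -> 0 <= al -> 0 <= ar -> 0 <= e ->
  enorm (S y - S x) <= sg * e -> enorm (S z - S y) <= sg * e ->
  enorm (A y - A x) <= al * e -> enorm (A y - A x) <= al * e ^+ 2 ->
  enorm (area_of J y z) <= ar * e ^+ 2 ->
  `|germ J x y + germ J y z - germ J x z| <=
    K * ((sg ^+ 2 + al) * sg + (sg + al) * ar) * e ^+ 3.
Proof.
move=> sg0 al0 ar0 e0 h1 h2 h3 h4 h5; have K0 := C2_le_ge0 gK.
apply: (le_trans (germ_delta_le _ _ _ _)).
have -> : K * ((sg ^+ 2 + al) * sg + (sg + al) * ar) * e ^+ 3 =
    K * ((sg * e) ^+ 2 + al * e ^+ 2) * (sg * e) + K * (sg * e + al * e) * (ar * e ^+ 2).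
  by ring.
apply: lerD; apply: ler_pM; rewrite ?mulr_ge0 ?addr_ge0 ?enorm_ge0 ?exprn_ge0 ?enorm_ge0//;
  rewrite ler_wpM2l// lerD//.
by rewrite ler_pXn2r// nnegrE ?enorm_ge0// mulr_ge0.
Qed.

End Germ.

(** * Powers, controls and restricted partitions *)

Section PowerBounds.
Variable R : realType.

Lemma interpolation (x C a b l : R) : 0 <= x -> 0 <= C -> 0 <= a -> 0 <= b ->
  0 < l < 1 -> x <= C * a -> x <= C * b -> x <= C * (a `^ l * b `^ (1 - l)).
Proof.
move=> x0 C0 a0 b0 /andP[l0 l1] xa xb.
have split y : 0 <= y -> y = y `^ l * y `^ (1 - l) :> R.
  move=> y0; rewrite -powRD; last by rewrite subrKC oner_eq0.
  by rewrite subrKC powRr1.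
rewrite [leLHS]split// [in leRHS](split C)// mulrACA.
by rewrite -!powRM// ler_pM ?powR_ge0// ge0_ler_powR ?nnegrE ?mulr_ge0// ?subr_ge0 ltW.
Qed.

Lemma powR_root (x p : R) : p != 0 -> 0 <= x -> (x `^ p) `^ p^-1 = x.
Proof. by move=> p0 x0; rewrite -powRrM divff ?powRr1. Qed.

Lemma powR_invE (x p : R) n : 0 <= x -> x `^ (n%:R / p) = (x `^ p^-1) ^+ n.
Proof. by move=> x0; rewrite -powR_mulrn ?powR_ge0// -powRrM mulrC. Qed.

Lemma le_powR_inv (x y p : R) : 0 < p -> 0 <= x -> x `^ p <= y -> x <= y `^ p^-1.
Proof.
move=> p0 x0 xy; rewrite -[leLHS](@powR_root _ p) ?gt_eqF//.
by rewrite ge0_ler_powR ?nnegrE ?powR_ge0 ?invr_ge0 ?(ltW p0)// (le_trans _ xy) ?powR_ge0.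
Qed.

(** For u <= 1, a <= u <= u^r; for u > 1, a <= M <= M u^r. This is how an increment of [A] is used
    at the orders 1/p and 2/p. *)
Lemma le_bounded_powR (a u M r : R) : 0 <= a -> a <= u -> a <= M -> 1 <= M -> 0 < r <= 1 ->
  a <= M * u `^ r.
Proof.
move=> a0 au aM M1 /andP[r0 r1]; have u0 := le_trans a0 au.
have [u1|u1] := leP u 1.
  apply: (le_trans au); apply: (@le_trans _ _ (u `^ r)); last first.
    by rewrite ler_peMl ?powR_ge0.
  have [->|un] := eqVneq u 0; first by rewrite powR_ge0.
  by apply: ger1_powR => //; rewrite u1 andbT lt_neqAle eq_sym un.
apply: (le_trans aM); rewrite ler_peMr ?(le_trans _ M1)//.
by rewrite -(powRr0 u) ler_powR ?ltW.
Qed.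

Lemma small_powR (c r eta : R) : 0 <= c -> 0 < r -> 0 < eta ->
  exists2 e : R, 0 < e <= 1 & c * e `^ r <= eta.
Proof.
move=> c0 r0 eta0; have c1 : 0 < c + 1 by rewrite ltr_wpDl.
pose b := eta / (c + 1); have b0 : 0 < b by rewrite divr_gt0.
exists (Num.min 1 (b `^ r^-1)); first by rewrite lt_min ltr01 powR_gt0//= ge_min lexx.
apply: (@le_trans _ _ (c * b)).
  have rE : (b `^ r^-1) `^ r = b by rewrite -powRrM mulVf ?powRr1 ?gt_eqF// ltW.
  rewrite ler_wpM2l// -[leRHS]rE.
  rewrite ge0_ler_powR ?nnegrE ?(ltW r0) ?powR_ge0// ?ge_min ?lexx ?orbT//.
  by rewrite le_min ler01 powR_ge0.
by rewrite /b mulrCA ler_piMr ?(ltW eta0)// ler_pdivrMr// mul1r lerDl.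
Qed.
End PowerBounds.

Section ControlSums.
Variable R : realType.

Lemma control_mono T (w : R -> R -> R) s s' t' t : control T w ->
  0 <= s -> s <= s' -> s' <= t' -> t' <= t -> t <= T -> w s' t' <= w s t.
Proof.
move=> [w0 wa] s0 ss' st' tt tT.
have h1 := wa s s' t s0 ss' (le_trans st' tt) tT.
have h2 := wa s' t' t (le_trans s0 ss') st' tt tT.
have h3 := w0 s s' s0 ss' (le_trans (le_trans st' tt) tT).
have h4 := w0 t' t (le_trans (le_trans s0 ss') st') tt tT.
lra.
Qed.

Lemma psum_control T (w : R -> R -> R) x s : control T w -> 0 <= x ->
  path <%R x s -> last x s <= T -> psum w x s <= w x (last x s).
Proof.
move=> cw; have [w0 wa] := cw; elim: s x => [|y s ih] x x0 /=.
  by move=> _ xT; exact: w0.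
move=> /andP[xy ys] lT.
have yl : y <= last y s by apply: path_le_last => //; rewrite mem_head.
apply: le_trans (wa x y _ x0 (ltW xy) yl lT).
by rewrite lerD2l ih// (le_trans x0 (ltW xy)).
Qed.

End ControlSums.

(** * Points of the partitions stopped at a time t *)

Section RestrictedPartition.
Variables (R : realType) (P : nat -> set R).
Hypothesis lfP : forall n, locfin_partition (P n).

Lemma partition0 n : P n 0. Proof. by case: (lfP n). Qed.

Lemma partition_ge0 n a : P n a -> 0 <= a.
Proof. by case: (lfP n) => + _ _ _ => /[apply]; rewrite /= in_itv /= andbT. Qed.

Lemma restr_partitionE n t a : 0 <= t ->
  restr_partition (P n) t a <-> a = t \/ P n a /\ a <= t.
Proof.
move=> t0; rewrite /restr_partition /=; split.
  move=> [[Pa|[->|->]]] /=; rewrite in_itv /= => /andP[a0 at']; [|right|by left].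
    by right.
  by split => //; exact: partition0.
move=> [->|[Pa at']]; split; rewrite /= ?in_itv /= ?lexx ?t0 ?at' ?(partition_ge0 Pa)//.
- by right; right.
- by left.
Qed.

Lemma finite_upto_locfin n y : finite_upto (P n) y.
Proof.
have [sub P0 fP uP] := lfP n; have [b Pb yb] := uP y.
exists b; split; rewrite ?ltW//; apply: sub_finite_set (fP b) => a [Pa /= ab].
by split => //=; rewrite in_itv /= ab (partition_ge0 Pa).
Qed.

Lemma restr_partition_pts n t : 0 <= t ->
  let X := restr_partition (P n) t in
  [/\ finite_set X, X `<=` `[0, t], X 0 & X t].
Proof.
by move=> t0; apply: restr_partition_fin => //; case: (lfP n).
Qed.

Lemma pts_restr n t : 0 <= t ->
  let s := pts (restr_partition (P n) t) in
  [/\ path <%R 0 s, last 0 s = t & forall a, (a \in 0 :: s) <-> restr_partition (P n) t a].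
Proof. by move=> t0; have [f1 f2 f3 f4] := restr_partition_pts n t0; exact: pts_spec. Qed.

Lemma finite_upto_restr n T y : 0 <= T -> y <= T ->
  finite_upto (restr_partition (P n) T) y.
Proof.
move=> T0 yT; have [f1 f2 f3 f4] := restr_partition_pts n T0.
by exists T; split => //; exact: finite_setIl.
Qed.

Lemma partition_sum_locfin (V : zmodType) n t (h : R -> R -> V) : 0 <= t ->
  partition_sum (P n) h t =
  psum (fun u v => h u v - h u u) 0 (pts (restr_partition (P n) t)).
Proof.
move=> t0; have [f1 f2 f3 f4] := restr_partition_pts n t0.
apply: partition_sum_pts => //; first exact: finite_upto_locfin.
  by case: (lfP n).
move=> a a0 at'; rewrite restr_partitionE//; split; last by right; rewrite ltW.
by case=> [e|[]//]; rewrite e ltxx in at'.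
Qed.

Lemma partition_sum_restr_incr (V : zmodType) n T x y (h : R -> R -> V) :
  0 <= x -> x < y -> y <= T -> P n x -> (forall a, P n a -> ~ (x < a < y)) ->
  partition_sum (restr_partition (P n) T) h y -
  partition_sum (restr_partition (P n) T) h x = h x y - h x x.
Proof.
move=> x0 xy yT Px nP; have T0 : 0 <= T by rewrite (le_trans x0)// (le_trans (ltW xy)).
have xT : x <= T := le_trans (ltW xy) yT.
apply: partition_sum_incr => //; first exact: finite_upto_restr.
  by apply/restr_partitionE => //; right.
move=> a /restr_partitionE => /(_ T0)[->|[Pa _]]; last exact: nP.
by rewrite (ltNge T) yT andbF.
Qed.

(** One bound for all stopping times up to [T]: the error of exchanging areas on a fixed partition
    is proportional to the number of its points and must be uniform in [t]. *)
Lemma size_pts_restr n T : exists N, forall t, 0 <= t -> t <= T ->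
  (size (pts (restr_partition (P n) t)) <= N)%N.
Proof.
have [_ _ fP _] := lfP n; have /finite_seqP[s es] := fP T.
exists (size s).+1 => t t0 tT; have [ps lp mp] := pts_restr n t0.
apply: (@uniq_leq_size _ _ (t :: s)).
  by apply: (sorted_uniq lt_trans ltxx); exact: path_sorted ps.
move=> a as'; rewrite inE; have /mp/restr_partitionE : a \in 0 :: pts (restr_partition (P n) t).
  by rewrite inE as' orbT.
move=> /(_ t0)[->|[Pa at']]; first by rewrite eqxx.
apply/orP; right; suff : [set` s] a by [].
by rewrite -es; split => //=; rewrite in_itv /= (partition_ge0 Pa) (le_trans at').
Qed.

Hypothesis nP : nested P.

Lemma nested_le k m : (k <= m)%N -> P k `<=` P m.
Proof.
elim: m => [|m ih]; first by rewrite leqn0 => /eqP->.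
by rewrite leq_eqVlt => /orP[/eqP->//|/ih h]; exact: subset_trans (nP (n:=m)).
Qed.

(** Nestedness in the form used by [sewing]: the coarse partition is the fine one filtered by
    membership. *)
Lemma filter_pts k m t : (k <= m)%N -> 0 <= t ->
  [seq a <- pts (restr_partition (P m) t) | a \in 0 :: pts (restr_partition (P k) t)] =
  pts (restr_partition (P k) t).
Proof.
move=> km t0; have [ps lp mp] := pts_restr k t0; have [ps' lp' mp'] := pts_restr m t0.
apply: (@irr_sorted_eq _ <%R lt_trans ltxx).
- by apply: sorted_filter; [exact: lt_trans|exact: path_sorted ps'].
- exact: path_sorted ps.
move=> a; rewrite mem_filter inE; have [->|a0] /= := eqVneq a 0.
  have := order_path_min lt_trans ps; have := order_path_min lt_trans ps'.
  by move=> /allP h1 /allP h2; apply/idP/idP => [/h1|/h2]; rewrite ltxx.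
apply/andP/idP => [[//]|ak]; split => //.
have : a \in 0 :: pts (restr_partition (P m) t).
  apply/mp'/restr_partitionE => //.
  have /mp/restr_partitionE : a \in 0 :: pts (restr_partition (P k) t) by rewrite inE ak orbT.
  by move=> /(_ t0)[->|[Pa at']]; [left|right; split => //; exact: (nested_le km)].
by rewrite inE (negbTE a0).
Qed.

End RestrictedPartition.

(** * Convergence along the partitions *)

Section Convergence.
Variables (R : realType) (p : R) (d dA : nat).
Variables (S : R -> 'rV[R]_d) (A : R -> 'rV[R]_dA) (P : nat -> set R).
Hypotheses (p_gt2 : 2 < p) (p_lt3 : p < 3).
Hypothesis ppS : price_path p P S.

Let lfP : forall n, locfin_partition (P n). Proof. by case: ppS. Qed.
Let nP : nested P. Proof. by case: ppS. Qed.
Let p0 : 0 < p. Proof. by apply: lt_trans p_gt2. Qed.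

Let invp_le1 : p^-1 <= 1.
Proof. by rewrite invf_le1// ltW// (lt_trans _ p_gt2)// ltr1n. Qed.

Lemma discr_capital_psum n (phi : R -> 'rV[R]_d) t : 0 <= t ->
  discr_capital (P n) S phi t =
  psum (fun u v => frob (phi u) (S v - S u)) 0 (pts (restr_partition (P n) t)).
Proof.
move=> t0.
have -> : discr_capital (P n) S phi t =
    partition_sum (P n) (fun u r => frob (phi u) (S r)) t.
  apply: eq_fsbigr => uv _; rewrite -frobBr /frob big_ord1.
  by apply: eq_bigr => i _; rewrite !mxE.
rewrite (partition_sum_locfin lfP)//; apply: eq_psum_consecutive => *.
by rewrite frobBr.
Qed.

Section Horizon.
Variables (T : R).
Hypothesis T0 : 0 < T.

Let J n : R -> 'M[R]_d := discr_int (restr_partition (P n) T) S.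
Let I : R -> 'M[R]_d := rie_int (fun n => restr_partition (P n) T) S.

(** Up to the next partition point, the discrete integral has the constant integrand [S x]. The end
    [y] may be any stopping time in between. *)
Lemma discr_int_incr n x y : P n x -> x < y -> y <= T ->
  (forall a, P n a -> ~ (x < a < y)) -> area_of S (J n) x y = 0.
Proof.
move=> Px xy yT h; rewrite /area_of.
have JE t : J n t =
    partition_sum (restr_partition (P n) T) (fun u r => tens (S u) (S r)) t.
  by apply: eq_fsbigr => uv _; rewrite tensBr.
rewrite !JE (partition_sum_restr_incr lfP _ (partition_ge0 lfP Px))//.
by rewrite -tensBr subrr.
Qed.

Lemma pts_consecutive n t s1 u v s2 : 0 <= t -> t <= T ->
  0 :: pts (restr_partition (P n) t) = s1 ++ u :: v :: s2 ->
  [/\ P n u, u < v, v <= T & forall a, P n a -> ~ (u < a < v)].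
Proof.
move=> t0 tT e; have [ps lp mp] := pts_restr lfP n t0.
have [um vm uv h] := path_consecutive ps e.
have vt : v <= t by rewrite -lp; apply: path_le_last => //; rewrite inE vm orbT.
split => //; last first.
- move=> a Pa /andP[ua av]; have : a \in 0 :: pts (restr_partition (P n) t).
    by apply/mp/(restr_partitionE lfP) => //; right; rewrite (le_trans (ltW av)).
  by move/h; rewrite !leNgt ua av => -[].
- exact: le_trans tT.
move: um => /mp/(restr_partitionE lfP) => /(_ t0)[e'|[]//].
by move: uv; rewrite e' ltNge vt.
Qed.

Lemma discr_capital_germ n g t : 0 <= t -> t <= T ->
  discr_capital (P n) S (strategy S A g) t =
  psum (germ S A g (J n)) 0 (pts (restr_partition (P n) t)).
Proof.
move=> t0 tT; rewrite discr_capital_psum//; apply: eq_psum_consecutive => s1 u v s2 e.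
have [Pu uv vT nuv] := pts_consecutive t0 tT e.
by rewrite /germ discr_int_incr// frob0r addr0.
Qed.

Variables (w : R -> R -> R) (al : R).
Hypothesis cw : control T w.
Hypothesis wS : forall s t, 0 <= s -> s <= t -> t <= T ->
  enorm (incr S s t) `^ p <= w s t.
Hypothesis wJ : forall n s t, restr_partition (P n) T s ->
  restr_partition (P n) T t -> s < t ->
  enorm (discr_int (restr_partition (P n) T) S t -
         discr_int (restr_partition (P n) T) S s - tens (S s) (incr S s t))
        `^ (p / 2) <= w s t.

Lemma enorm_incr_w s t : 0 <= s -> s <= t -> t <= T ->
  enorm (S t - S s) <= w s t `^ p^-1.
Proof. by move=> s0 st tT; apply: le_powR_inv; rewrite ?enorm_ge0// wS. Qed.

Lemma enorm_area_w n s t : restr_partition (P n) T s ->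
  restr_partition (P n) T t -> s < t ->
  enorm (area_of S (J n) s t) <= (w s t `^ p^-1) ^+ 2.
Proof.
move=> Rs Rt st; have := wJ Rs Rt st => /le_powR_inv; rewrite -/(area_of S (J n) s t).
have [w0 _] := cw; have h a : restr_partition (P n) T a -> 0 <= a <= T.
  by case=> _ /=; rewrite in_itv.
have /andP[s0 _] := h _ Rs; have /andP[_ tT] := h _ Rt.
by rewrite invf_div powR_invE ?w0 ?(ltW st)//; apply; rewrite ?divr_gt0 ?enorm_ge0.
Qed.

(* The right endpoint z is either a partition point or the time at which the
   integral is stopped. *)
Lemma enorm_area_stopped n y z : P n y -> y < z -> z <= T ->
  enorm (area_of S (J n) y z) <= 2 * (w y z `^ p^-1) ^+ 2.
Proof.
move=> Py yz zT; have y0 := partition_ge0 lfP Py; have z0 := le_trans y0 (ltW yz).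
have [w0 _] := cw.
have wle s t : y <= s -> s <= t -> t <= z -> w s t `^ p^-1 <= w y z `^ p^-1.
  move=> ys st tz; have s0 := le_trans y0 ys.
  rewrite ge0_ler_powR ?nnegrE ?invr_ge0 ?(ltW p0) ?w0 ?(ltW yz) ?(le_trans tz)//.
  exact: (control_mono cw).
have yT : y <= T := le_trans (ltW yz) zT.
have Ry : restr_partition (P n) T y by apply/(restr_partitionE lfP); [exact: ltW|right].
have e0 : 0 <= (w y z `^ p^-1) ^+ 2 by rewrite exprn_ge0 ?powR_ge0.
have [Rz|nRz] := pselect (restr_partition (P n) T z).
  by apply: (le_trans (enorm_area_w Ry Rz yz)); lra.
have zT' : z < T.
  rewrite lt_neqAle zT andbT; apply/eqP => e; apply: nRz.
  by apply/(restr_partitionE lfP); [exact: ltW|left].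
have [[u v] [suv /= uz zv]] := covering_subitv (finite_upto_locfin lfP n T) (partition0 lfP n) z0 zT'.
have [/= Pu Pv uv nuv] := suv.
have yu : y <= u by rewrite leNgt; apply/negP => uy; apply: (nuv y Py); rewrite uy (lt_trans yz).
have Ru : restr_partition (P n) T u.
  by apply/(restr_partitionE lfP); [exact: ltW|right; rewrite (le_trans uz)].
have uz' : u < z.
  by rewrite lt_neqAle uz andbT; apply/eqP => e; apply: nRz; rewrite -e.
(* Chen's relation at the last partition point [u] before [z]: the area beyond [u] vanishes; the
   area up to [u] and the tensor term cost one square each, whence the factor 2. *)
rewrite (area_chen S (J n) y u z) (discr_int_incr Pu uz' zT); last first.
  by move=> a Pa /andP[ua az]; apply: (nuv a Pa); rewrite ua (lt_trans az).
rewrite addr0 mulr2n mulrDl mul1r; apply: (le_trans (ler_enormD _ _)); apply: lerD.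
  have [<-|yu'] := eqVneq y u.
    by rewrite /area_of !subrr /tens mulmx0 subrr enorm0.
  apply: (le_trans (enorm_area_w Ry Ru _)); first by rewrite lt_neqAle yu'.
  by rewrite ler_pXn2r ?nnegrE ?powR_ge0 ?wle.
apply: (le_trans (enorm_tens _ _)); rewrite expr2; apply: ler_pM; rewrite ?enorm_ge0//.
  by apply: le_trans (wle y u _ _ _); rewrite ?enorm_incr_w ?(le_trans uz).
by apply: le_trans (wle u z _ _ _); rewrite ?enorm_incr_w ?(le_trans y0).
Qed.

Hypothesis varA : forall s, path <%R 0 s -> last 0 s <= T ->
  psum (fun u v => enorm (A v - A u)) 0 s <= al.

(** One weight for [S], the areas and [A]. The summand 1 in [M] secures 1 <= M, as [le_bounded_powR]
    requires. *)
Let W x y := w x y + enorm (A y - A x).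
Let M := w 0 T + al + 1.

Lemma psum_W s : path <%R 0 s -> last 0 s <= T -> psum W 0 s <= M - 1.
Proof.
move=> ps lT; rewrite psumD /M addrK; apply: lerD; last exact: varA.
apply: (le_trans (psum_control cw (lexx 0) ps lT)).
apply: (control_mono cw) => //.
by apply: path_le_last => //; rewrite mem_head.
Qed.

Lemma M_ge1 : 1 <= M.
Proof. by have := @psum_W [::] isT (ltW T0); rewrite /= subr_ge0. Qed.

Lemma W_bounds x y : 0 <= x -> x < y -> y <= T -> [/\ 0 <= w x y, w x y <= W x y,
  enorm (A y - A x) <= W x y & W x y <= M].
Proof.
move=> x0 xy yT; have [w0 _] := cw; have wxy : 0 <= w x y by rewrite w0// ltW.
split; rewrite /W ?lerDl ?lerDr ?enorm_ge0//.
have le1 : w x y <= w 0 T by apply: (control_mono cw) => //; exact: ltW.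
rewrite /M -addrA; apply: lerD => //.
apply: (@le_trans _ _ al); last by rewrite lerDl.
have [->|xn] := eqVneq x 0.
  have y0 : 0 < y := le_lt_trans x0 xy.
  by have := @varA [:: y]; rewrite /= y0 addr0; apply.
have xp : 0 < x by rewrite lt_neqAle eq_sym xn.
have := @varA [:: x; y]; rewrite /= xp xy addr0 => /(_ isT yT).
by apply: le_trans; rewrite lerDr enorm_ge0.
Qed.

Variables (g : 'rV[R]_(d + dA) -> 'rV[R]_d) (K : R).
Hypothesis gK : C2_le g K.

(** The 6 comes from [germ_delta_osc], whose two products cost 2 K M e and 4 K M e; the bound in
    [germ_delta_w] has factor 3. *)
Let C := 6 * K * (1 + M).

Let K0 : 0 <= K. Proof. exact: C2_le_ge0 gK. Qed.

Lemma germ_delta_w n x y z : 0 <= x -> x < y -> y < z -> z <= T -> P n y ->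
  `|germ S A g (J n) x y + germ S A g (J n) y z - germ S A g (J n) x z| <=
    C * (W x y + W y z) `^ (3 / p).
Proof.
move=> x0 xy yz zT Py; have y0 := ltW (le_lt_trans x0 xy).
have yT := le_trans (ltW yz) zT; have M1 := M_ge1.
have [a1 a2 a3 a4] := W_bounds x0 xy yT; have [b1 b2 b3 b4] := W_bounds y0 yz zT.
set u := W x y + W y z; have W1 : 0 <= W x y := le_trans a1 a2.
have W2 : 0 <= W y z := le_trans b1 b2.
have u0 : 0 <= u by rewrite addr_ge0.
pose e := u `^ p^-1; have e0 : 0 <= e by rewrite powR_ge0.
have mono a : 0 <= a -> a <= u -> a `^ p^-1 <= e.
  by move=> ha au; rewrite ge0_ler_powR ?nnegrE ?invr_ge0 ?(ltW p0).
have m1 : w x y `^ p^-1 <= e by rewrite mono// (le_trans a2)// lerDl.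
have m2 : w y z `^ p^-1 <= e by rewrite mono// (le_trans b2)// lerDr.
have Au : enorm (A y - A x) <= u by rewrite (le_trans a3)// lerDl.
have p1 := invp_le1.
have p2 : 2 / p <= 1 by rewrite ler_pdivrMr// mul1r ltW.
have AM : enorm (A y - A x) <= M := le_trans a3 a4.
have := @germ_delta_scale R d dA S A g K gK (J n) x y z 1 M 2 e ler01
  (le_trans ler01 M1) (ler0n R 2) e0.
rewrite !mul1r expr1n mulr1 powR_invE// -/e => h.
apply: (@le_trans _ _ (K * (1 + M + (1 + M) * 2) * e ^+ 3)); last first.
  rewrite ler_wpM2r ?exprn_ge0// /C; have KM : 0 <= K * M by rewrite mulr_ge0// (le_trans _ M1).
  have := K0; nra.
apply: h.
- by apply: le_trans m1; rewrite enorm_incr_w ?(ltW xy).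
- by apply: le_trans m2; rewrite enorm_incr_w ?(ltW yz).
- by apply: le_bounded_powR => //; rewrite ?enorm_ge0// invr_gt0 p0.
- rewrite -powR_invE//; apply: le_bounded_powR => //; rewrite ?enorm_ge0//.
  by rewrite divr_gt0.
- apply: (le_trans (enorm_area_stopped Py yz zT)); rewrite ler_wpM2l//.
  by rewrite ler_pXn2r ?nnegrE ?powR_ge0.
Qed.

(** Each product of the defect has a factor over [[x, y]], small with [e], and a factor over
    [[y, z]] that need only be bounded. Hence no smallness is asked up to [z], where a jump does no
    harm. *)
Lemma germ_delta_osc n x y z (e : R) : 0 <= x -> x < y -> y < z -> z <= T -> P n y ->
  0 <= e -> e <= 1 -> enorm (S y - S x) <= e -> enorm (A y - A x) <= e ->
  `|germ S A g (J n) x y + germ S A g (J n) y z - germ S A g (J n) x z| <= C * e.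
Proof.
move=> x0 xy yz zT Py e0 e1 hS hA; have y0 := ltW (le_lt_trans x0 xy).
have M1 := M_ge1.
have [b1 b2 b3 b4] := W_bounds y0 yz zT.
have wM' : w y z <= M := le_trans b2 b4; have M0 : 0 <= M by lra.
have wM : w y z `^ p^-1 <= M.
  apply: (@le_trans _ _ (M `^ p^-1)).
    by rewrite ge0_ler_powR ?nnegrE ?invr_ge0 ?(ltW p0).
  by apply: ler1_powR => //; exact: invp_le1.
have wM2 : (w y z `^ p^-1) ^+ 2 <= M.
  rewrite -powR_invE//; apply: (@le_trans _ _ (M `^ (2 / p))).
    by rewrite ge0_ler_powR ?nnegrE ?divr_ge0 ?(ltW p0).
  by apply: ler1_powR => //; rewrite ler_pdivrMr// mul1r ltW.
have hS2 : enorm (S z - S y) <= M.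
  by apply: le_trans wM; rewrite enorm_incr_w ?(ltW yz).
have hJ : enorm (area_of S (J n) y z) <= 2 * M.
  by apply: (le_trans (enorm_area_stopped Py yz zT)); rewrite ler_wpM2l.
apply: (le_trans (germ_delta_le S A gK _ _ _ _)).
have sq : enorm (S y - S x) ^+ 2 <= e.
  have := enorm_ge0 (S y - S x); nra.
apply: (@le_trans _ _ (K * (e + e) * M + K * (e + e) * (2 * M))).
  apply: lerD; apply: ler_pM; rewrite ?mulr_ge0 ?addr_ge0 ?exprn_ge0 ?enorm_ge0 ?K0//;
    by rewrite ler_wpM2l// lerD.
rewrite /C; have : 0 <= K * e by rewrite mulr_ge0.
nra.
Qed.


(** The midpoint of p / 3 and 1: any value strictly in between keeps the exponent 3 / p * l above 1
    and leaves a positive power of the oscillation. *)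
Let l := (1 + p / 3) / 2.
Let th := 3 / p * l.
Let Csew := C * (1 + (th - 1)^-1) * (2 * M) `^ th.

Let l01 : 0 < l < 1.
Proof. by move: p_gt2 p_lt3 => h2 h3; apply/andP; rewrite /l; split; lra. Qed.

Let th_gt1 : 1 < th.
Proof.
rewrite /th /l mulrAC ltr_pdivlMr// mul1r; move: p_gt2 p_lt3 => h2 h3.
lra.
Qed.

Let C0 : 0 <= C.
Proof. by rewrite mulr_ge0// ?mulr_ge0// addr_ge0// (le_trans ler01 M_ge1). Qed.

Let Csew0 : 0 <= Csew.
Proof.
rewrite mulr_ge0 ?powR_ge0// mulr_ge0// addr_ge0// invr_ge0 subr_ge0.
exact: ltW th_gt1.
Qed.

Lemma germ_refine e k m t : 0 < e <= 1 -> (k <= m)%N -> 0 <= t -> t <= T ->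
  (forall u v x, subitvs (restr_partition (P k) T) (u, v) -> u <= x -> x < v ->
     enorm (S x - S u) <= e / 2 /\ enorm (A x - A u) <= e / 2) ->
  `|psum (germ S A g (J m)) 0 (pts (restr_partition (P m) t)) -
    psum (germ S A g (J m)) 0 (pts (restr_partition (P k) t))| <= Csew * e `^ (1 - l).
Proof.
move=> /andP[e0 e1] km t0 tT osc.
have [ps lp mp] := pts_restr lfP m t0; have [pk lk mk] := pts_restr lfP k t0.
pose q : pred R := fun a => a \in 0 :: pts (restr_partition (P k) t).
rewrite -(filter_pts lfP nP km t0) -/q.
have -> : Csew * e `^ (1 - l) =
    C * e `^ (1 - l) * (1 + (th - 1)^-1) * (2 * M) `^ th by rewrite /Csew; ring.
have xT x : x \in 0 :: pts (restr_partition (P m) t) -> 0 <= x <= t.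
  move=> xm; apply/andP; split; first exact: path_ge_head ps xm.
  by rewrite -[leRHS]lp; exact: path_le_last.
(* [sewing] asks for a nonnegative weight at all pairs of points, even for u > v where nothing is
   known about [w]; hence the absolute value. *)
apply: (@sewing R (germ S A g (J m)) (fun u v => `|W u v|) q) => //.
- by rewrite mulr_ge0 ?powR_ge0.
- exact: le_trans ler01 M_ge1.
- by rewrite /q inE eqxx.
- by rewrite lp; apply/mk/(restr_partitionE lfP) => //; left.
- move=> s' ps' ls' ss'.
  have -> : psum (fun u v => `|W u v|) 0 s' = psum W 0 s'.
    apply: eq_psum_consecutive => s1 u v s2 es.
    have [um vm uv _] := path_consecutive ps' es.
    have u0 : 0 <= u by exact: path_ge_head ps' um.
    have vT : v <= T.
      by apply: le_trans tT; rewrite -lp -ls'; apply: path_le_last => //; rewrite inE vm orbT.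
    have [h1 h2 _ _] := W_bounds u0 uv vT.
    by rewrite ger0_norm// (le_trans h1).
  apply: (le_trans (psum_W ps' _)); first by rewrite ls' lp.
  by rewrite lerBlDr lerDl.
move=> u v z um vm zm uv vz nq.
have /andP[u0 _] := xT _ um; have /andP[_ zt] : 0 <= z <= t by apply: xT; rewrite inE zm orbT.
have vt : v < t := lt_le_trans vz zt.
have zT := le_trans zt tT; have vT := ltW (lt_le_trans vz zT).
have Pv : P m v.
  have /mp/(restr_partitionE lfP) : v \in 0 :: pts (restr_partition (P m) t) by rewrite inE vm orbT.
  by move=> /(_ t0)[e'|[]//]; rewrite e' ltxx in vt.
have [a1 a2 _ _] := W_bounds u0 uv vT.
have v0 : 0 <= v := le_trans u0 (ltW uv).
have [b1 b2 _ _] := W_bounds v0 vz zT.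
rewrite (ger0_norm (le_trans a1 a2)) (ger0_norm (le_trans b1 b2)).
have uT : u < T := lt_le_trans uv vT.
(* The interval is taken in the partition of [[0, T]], where the oscillation bound is stated. If its
   end [b] were at most [v], it would be a kept point strictly between [u] and [z]; so [u] and [v]
   share this interval, and comparing both with [a] turns e / 2 into e. *)
have [[a b] [sab /= au ub]] := covering_subitv (finite_upto_restr lfP k (ltW T0) (lexx T))
  (proj2 (restr_partitionE lfP k 0 (ltW T0)) (or_intror (conj (partition0 lfP k) (ltW T0)))) u0 uT.
have vb : v < b.
  rewrite ltNge; apply/negP => bv; have [_ /= Rb _ _] := sab.
  have bt : b < t := le_lt_trans bv vt.
  have Pb : P k b.
    move: Rb => /(restr_partitionE lfP) => /(_ (ltW T0))[e'|[]//].
    by move: bt; rewrite e' ltNge tT.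
  have qb : q b by apply/mk/(restr_partitionE lfP) => //; right; rewrite ltW.
  have bm : b \in pts (restr_partition (P m) t).
    have : b \in 0 :: pts (restr_partition (P m) t).
      apply/mp/(restr_partitionE lfP) => //; right; rewrite ltW//; split => //.
      exact: (nested_le nP km).
    by rewrite inE => /orP[/eqP b0|//]; move: ub; rewrite b0 ltNge u0.
  by have := nq b ub (le_lt_trans bv vz) bm; rewrite qb.
have [oS oA] : enorm (S v - S u) <= e /\ enorm (A v - A u) <= e.
  have [h1 h2] := osc a b u sab au ub; have [h3 h4] := osc a b v sab (le_trans au (ltW uv)) vb.
  split; [apply: (le_trans (enorm_distD (S a) _ _))|apply: (le_trans (enorm_distD (A a) _ _))];
    by rewrite [leRHS]splitr lerD// enormBC.
set x := Num.norm _.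
have -> : C * e `^ (1 - l) * (W u v + W v z) `^ th =
   C * (((W u v + W v z) `^ (3 / p)) `^ l * e `^ (1 - l)).
  by rewrite -powRrM mulrA mulrAC.
apply: interpolation; rewrite ?powR_ge0 ?(ltW e0)//.
- exact: normr_ge0.
- exact: germ_delta_w.
- by apply: germ_delta_osc => //; exact: ltW.
Qed.

Hypotheses (cA : cadlag `[0, +oo[ A) (jA : jump_times A `<=` \bigcup_n P n).

(** The order of choices matters: the oscillation fixes [k], the number of points of [P k] then
    fixes how close the integrals must be, and this fixes [N]. The comparison sum does not depend on
    [m]. *)
Lemma discr_capital_approx (eta : R) : 0 < eta -> exists k N, forall m, (N <= m)%N ->
  forall t, 0 <= t -> t <= T ->
  `|discr_capital (P m) S (strategy S A g) t -
    psum (germ S A g I) 0 (pts (restr_partition (P k) t))| <= eta.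
Proof.
move=> eta0; have eta2 : 0 < eta / 2 by rewrite divr_gt0.
have l1 : 0 < 1 - l by rewrite subr_gt0; case/andP: l01.
have [e /andP[e0 e1] he] := small_powR Csew0 l1 eta2.
have [_ _ _ mP /(_ T T0) RS] := ppS.
have e20 : 0 < e / 2 by rewrite divr_gt0.
have [k1 hk1] := RIE_oscillation RS e20.
(* The oscillation of [A] is known in the max norm; [dA + 1] pays for the passage to the Euclidean
   norm. *)
have c0 : 0 < (dA%:R + 1 : R) by rewrite ltr_wpDl.
have [k2 hk2] := cadlag_oscillation T0 cA jA nP (mP T T0) (divr_gt0 e20 c0).
pose k := maxn k1 k2; have [n hn] := size_pts_restr lfP k T.
have del0 : 0 < eta / 2 / (n%:R * (2 * K) + 1) by rewrite divr_gt0// ltr_wpDl// !mulr_ge0.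
have [N hN] := rie_int_cvg RS del0.
exists k, (maxn k N) => m; rewrite geq_max => /andP[km Nm] t t0 tT.
rewrite discr_capital_germ// [leRHS]splitr.
rewrite -[X in `|X|](subrKA (psum (germ S A g (J m)) 0 (pts (restr_partition (P k) t)))).
apply: (le_trans (ler_normD _ _)); apply: lerD.
  apply: (le_trans (germ_refine _ km t0 tT _)) he; first by rewrite e0.
  move=> u v x suv ux xv; split; first by apply: (hk1 k) suv ux xv; exact: leq_maxl.
  apply: (le_trans (enorm_le_normr _)); rewrite mul1n.
  have := hk2 k (leq_maxr _ _) u v x suv ux xv; rewrite ler_pdivlMr// => /(le_trans _); apply.
  by rewrite mulrC ler_wpM2l// lerDl.
rewrite -psumB; apply: (le_trans (ler_norm_psum _ _ _)).
have [ps lp mp] := pts_restr lfP k t0.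
pose del := eta / 2 / (n%:R * (2 * K) + 1).
apply: (@le_trans _ _ (psum (fun _ _ => K * (2 * del)) 0 (pts (restr_partition (P k) t)))).
  apply: ler_psum_consecutive => s1 u v s2 es.
  have [um vm uv _] := path_consecutive ps es.
  have u0 : 0 <= u by exact: path_ge_head ps um.
  have vT : v <= T.
    by apply: le_trans tT; rewrite -lp; apply: path_le_last => //; rewrite inE vm orbT.
  rewrite /germ opprD addrACA subrr add0r -frobBr.
  have -> : area_of S (J m) u v - area_of S I u v = (J m v - I v) - (J m u - I u).
    by rewrite /area_of; apply/matrixP => i j; rewrite !mxE; ring.
  apply: (le_trans (cauchy_schwarz _ _)); apply: ler_pM; rewrite ?enorm_ge0//.
    exact: enorm_strategy'.
  apply: (le_trans (ler_enormB _ _)); rewrite mulr2n mulrDl mul1r.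
  by apply: lerD; apply: hN => //; apply/andP; split; rewrite ?(le_trans u0) ?(ltW uv)//
     (le_trans (ltW uv)).
rewrite psum_const -[leLHS]mulr_natr.
have d0 : 0 <= del := ltW del0.
apply: (@le_trans _ _ (K * (2 * del) * n%:R)).
  apply: ler_wpM2l; last by rewrite ler_nat hn.
  exact: mulr_ge0 K0 (mulr_ge0 (ler0n R 2) d0).
have -> : K * (2 * del) * n%:R = n%:R * (2 * K) * del by ring.
rewrite /del mulrCA ler_piMr ?(ltW eta2)// ler_pdivrMr ?mul1r ?lerDl//.
by rewrite ltr_wpDl// !mulr_ge0.
Qed.

End Horizon.
End Convergence.

(** * Stability of the compensated sums *)

Section Stability.
Variables (R : realType) (p : R) (d dA : nat).
Variables (S : R -> 'rV[R]_d) (A : R -> 'rV[R]_dA) (J : R -> 'M[R]_d) (T : R).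
Variables (g : 'rV[R]_(d + dA) -> 'rV[R]_d) (K sg al ar : R).
Hypotheses (p_gt2 : 2 < p) (p_lt3 : p < 3) (T0 : 0 < T) (gK : C2_le g K).
Hypotheses (sg0 : 0 <= sg) (al0 : 0 <= al) (ar0 : 0 <= ar).

Lemma term_le_psum (F : R -> R -> R) (B u v : R) : (forall a b, 0 <= F a b) ->
  (forall c, path <%R 0 c -> last 0 c = T -> psum F 0 c <= B) ->
  0 <= u -> u < v -> v <= T -> F u v <= B.
Proof.
move=> F0 FB u0 uv vT.
(* The interval is completed to a partition of [[0, T]]; 0 and [T] must not be repeated, since the
   points increase strictly. *)
pose c := (if u == 0 then [::] else [:: u]) ++ v :: (if v == T then [::] else [:: T]).
apply: (le_trans _ (FB c _ _)).
- by rewrite /c; case: eqP => [->|_]; case: eqP => [->|_] /=;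
    rewrite ?addr0 ?lerDl ?lerDr ?addr_ge0 ?lexx// addrA addrAC lerDr addr_ge0.
- have vT' : v != T -> v < T by move=> n; rewrite lt_neqAle n.
  have u0' : u != 0 -> 0 < u by move=> n; rewrite lt_neqAle eq_sym n.
  by rewrite /c; case: eqVneq => [e|/u0' h]; case: eqVneq => [e'|/vT' h'] /=;
    rewrite ?h ?h' ?uv -?e ?uv.
- by rewrite /c; case: eqVneq => [e|h]; case: eqVneq => [e'|h'] /=.
Qed.

Hypothesis hS : forall c, path <%R 0 c -> last 0 c = T ->
  psum (fun u v => enorm (S v - S u) `^ p) 0 c <= sg `^ p.
Hypothesis hA : forall c, path <%R 0 c -> last 0 c = T ->
  psum (fun u v => enorm (A v - A u)) 0 c <= al.
Hypothesis hJ : forall c, path <%R 0 c -> last 0 c = T ->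
  psum (fun u v => enorm (area_of S J u v) `^ (p / 2)) 0 c <= ar `^ (p / 2).

Let p0 : 0 < p. Proof. exact: lt_trans p_gt2. Qed.
Let p20 : 0 < p / 2. Proof. by rewrite divr_gt0. Qed.

(* When a normalising constant vanishes, so do the increments, and the
   convention x / 0 = 0 is harmless. *)
Let W u v := (enorm (S v - S u) / sg) `^ p + enorm (A v - A u) / al +
  (enorm (area_of S J u v) / ar) `^ (p / 2).

Lemma psum_normalised (F : R -> R -> R) (b r : R) c : 0 <= b -> 0 < r ->
  (forall u v, 0 <= F u v) -> psum (fun u v => F u v `^ r) 0 c <= b `^ r ->
  psum (fun u v => (F u v / b) `^ r) 0 c <= 1.
Proof.
move=> b0 r0 F0 h; have [->|bn] := eqVneq b 0.
  rewrite (_ : psum _ _ _ = 0) ?ler01//.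
  rewrite (@eq_psum_consecutive _ _ _ (fun _ _ => 0)); last first.
    by move=> *; rewrite invr0 mulr0 powR0// gt_eqF.
  by rewrite psum_const mul0rn.
have bp : 0 < b by rewrite lt_neqAle eq_sym bn.
rewrite (@eq_psum_consecutive _ _ _ (fun u v => (b `^ r)^-1 * F u v `^ r)); last first.
  move=> _ u v _ _; rewrite powRM ?invr_ge0// mulrC; congr (_ * _).
  by rewrite -powR_inv1// -powRrM mulN1r powRN.
by rewrite psumZ mulrC ler_pdivrMr ?mul1r// powR_gt0.
Qed.

Lemma normalised_le (x b : R) : 0 <= x -> x <= b -> x = b * (x / b) /\ 0 <= x / b <= 1.
Proof.
move=> x0 xb; have b0 := le_trans x0 xb; have [e|bn] := eqVneq b 0.
  have -> : x = 0 by apply/le_anti; rewrite x0 andbT -e.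
  by rewrite mul0r mulr0 lexx ler01.
have bp : 0 < b by rewrite lt_neqAle eq_sym bn.
by rewrite mulrC divfK// divr_ge0//= ler_pdivrMr// mul1r.
Qed.

Lemma psum_W3 c : path <%R 0 c -> last 0 c = T -> psum W 0 c <= 3.
Proof.
move=> pc lc; rewrite /W !psumD.
have h1 : psum (fun u v => (enorm (S v - S u) / sg) `^ p) 0 c <= 1.
  by apply: psum_normalised => // [u v|]; [exact: enorm_ge0|exact: hS].
have h2 : psum (fun u v => (enorm (area_of S J u v) / ar) `^ (p / 2)) 0 c <= 1.
  by apply: psum_normalised => // [u v|]; [exact: enorm_ge0|exact: hJ].
have h3 : psum (fun u v => enorm (A v - A u) / al) 0 c <= 1.
  rewrite (@eq_psum_consecutive _ _ _ (fun u v => al^-1 * enorm (A v - A u))).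
    rewrite psumZ; have [->|aln] := eqVneq al 0; first by rewrite invr0 mul0r.
    by rewrite ler_pdivrMl ?mulr1 ?hA// lt_neqAle eq_sym aln.
  by move=> *; rewrite mulrC.
lra.
Qed.

Let root r (x y : R) : 0 < r -> 0 <= x -> 0 <= y -> x `^ r <= y `^ r -> x <= y.
Proof.
move=> r0 x0 y0 xy; have := le_powR_inv r0 x0 xy.
by rewrite powR_root// gt_eqF.
Qed.

Lemma increments_le u v : 0 <= u -> u < v -> v <= T ->
  [/\ enorm (S v - S u) <= sg, enorm (A v - A u) <= al &
      enorm (area_of S J u v) <= ar].
Proof.
move=> u0 uv vT; split.
- apply: (root p0 (enorm_ge0 _) sg0).
  by apply: (term_le_psum (F := fun u v => enorm (S v - S u) `^ p)) => // *; rewrite powR_ge0.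
- by apply: (term_le_psum (F := fun u v => enorm (A v - A u))) => // *; rewrite enorm_ge0.
- apply: (root p20 (enorm_ge0 _) ar0).
  by apply: (term_le_psum (F := fun u v => enorm (area_of S J u v) `^ (p / 2))) => // *; rewrite powR_ge0.
Qed.

(** The normalised increment of [A] is at most 1 and at most e^p, hence at most [e] and at most
    [e ^+ 2], by [le_bounded_powR] with constant 1. *)
Lemma W_estimates u v (e : R) : 0 <= u -> u < v -> v <= T -> 0 <= e -> W u v <= e `^ p ->
  [/\ enorm (S v - S u) <= sg * e, enorm (A v - A u) <= al * e,
      enorm (A v - A u) <= al * e ^+ 2 & enorm (area_of S J u v) <= ar * e ^+ 2].
Proof.
move=> u0 uv vT e0 We.
have x1 : 0 <= (enorm (S v - S u) / sg) `^ p by rewrite powR_ge0.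
have x2 : 0 <= enorm (A v - A u) / al by rewrite divr_ge0 ?enorm_ge0.
have x3 : 0 <= (enorm (area_of S J u v) / ar) `^ (p / 2) by rewrite powR_ge0.
move: We; rewrite /W => We.
have [t1 t2 t3] := increments_le u0 uv vT.
have [eS /andP[s0 s1]] := normalised_le (enorm_ge0 _) t1.
have [eA /andP[a0 a1]] := normalised_le (enorm_ge0 _) t2.
have [eJ /andP[j0 j1]] := normalised_le (enorm_ge0 _) t3.
have aW : enorm (A v - A u) / al <= e `^ p by apply: le_trans We; lra.
have apow r : 0 < r <= 1 -> enorm (A v - A u) / al <= (e `^ p) `^ r.
  by move=> hr; rewrite -[leRHS]mul1r; apply: le_bounded_powR.
have e1 : (e `^ p) `^ p^-1 = e by rewrite powR_root// gt_eqF.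
split.
- rewrite {1}eS ler_wpM2l// ; apply: (root p0) => //; apply: le_trans We; lra.
- rewrite {1}eA ler_wpM2l//; have := apow p^-1; rewrite e1; apply.
  by rewrite invr_gt0 p0 invf_le1// ltW// (lt_trans _ p_gt2)// ltr1n.
- rewrite {1}eA ler_wpM2l//; have := apow (2 / p); rewrite powR_invE ?powR_ge0// e1; apply.
  by rewrite divr_gt0//= ler_pdivrMr// mul1r ltW.
- rewrite {1}eJ ler_wpM2l//; apply: (root p20) => //; first exact: exprn_ge0.
  rewrite -powR_mulrn// -powRrM mulrCA divff ?mulr1 ?pnatr_eq0//.
  by apply: le_trans We; lra.
Qed.

(** Only 0 and [T] are kept, so the coarse sum is the single germ over [[0, T]]; it accounts for the
    leading 1 of the constant. The rest is Young's cost at the exponent 3 / p, where 6 is twice the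
    total weight 3. *)
Lemma germ_sum_bound s : path <%R 0 s -> last 0 s = T ->
  `|psum (germ S A g J) 0 s| <=
    (1 + (1 + (3 / p - 1)^-1) * 6 `^ (3 / p)) * K *
    (1 + sg ^+ 2 + al) * (1 + sg) * (2 * sg + ar).
Proof.
move=> ps ls; have K0 := C2_le_ge0 gK.
pose q : pred R := fun a => (a == 0) || (a == T).
have sE : [seq a <- s | q a] = [:: T].
  apply: (@irr_sorted_eq _ <%R lt_trans ltxx) => //.
    by apply: sorted_filter; [exact: lt_trans|exact: path_sorted ps].
  move=> a; rewrite mem_filter inE /q; have [->|aT] := eqVneq a T.
    rewrite orbT /=; have := mem_last 0 s; rewrite ls inE gt_eqF //= => ->.
  rewrite orbF; apply/negbTE/negP => /andP[/eqP -> s0].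
  by have := allP (order_path_min lt_trans ps) 0 s0; rewrite ltxx.
(* The factor that [germ_delta_scale] produces when each increment is measured by its own
   variation. *)
pose Q := (sg ^+ 2 + al) * sg + (sg + al) * ar.
have Q0 : 0 <= Q by rewrite /Q addr_ge0// mulr_ge0// addr_ge0// exprn_ge0.
have th1 : 1 < 3 / p by rewrite ltr_pdivlMr// mul1r.
have W0 u v : 0 <= W u v.
  by rewrite /W !addr_ge0 ?powR_ge0 ?divr_ge0 ?enorm_ge0.
have inT a : a \in 0 :: s -> 0 <= a <= T.
  by move=> am; rewrite (path_ge_head ps am) -ls path_le_last.
have main : `|psum (germ S A g J) 0 s - psum (germ S A g J) 0 [seq a <- s | q a]| <=
    K * Q * (1 + (3 / p - 1)^-1) * (2 * 3) `^ (3 / p).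
  apply: (@sewing R _ W q) => //.
  - by rewrite mulr_ge0.
  - by rewrite /q eqxx.
  - by rewrite /q ls eqxx orbT.
  - by move=> s' ps' ls' _; apply: psum_W3; rewrite ?ls'.
  move=> u v w um vm wm uv vw _.
  have /andP[u0 _] := inT _ um.
  have /andP[v0 vT] : 0 <= v <= T by apply: inT; rewrite inE vm orbT.
  have /andP[_ wT] : 0 <= w <= T by apply: inT; rewrite inE wm orbT.
  pose e := (W u v + W v w) `^ p^-1; have e0 : 0 <= e by exact: powR_ge0.
  have ep : e `^ p = W u v + W v w.
    have u1 : 0 <= W u v + W v w by exact: addr_ge0.
    by rewrite /e -powRrM mulVf ?powRr1 ?u1 ?gt_eqF.
  have [a1 a2 a3 _] : [/\ enorm (S v - S u) <= sg * e, enorm (A v - A u) <= al * e,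
      enorm (A v - A u) <= al * e ^+ 2 & enorm (area_of S J u v) <= ar * e ^+ 2].
    by apply: W_estimates; rewrite // ep lerDl.
  have [b1 _ _ b4] : [/\ enorm (S w - S v) <= sg * e, enorm (A w - A v) <= al * e,
      enorm (A w - A v) <= al * e ^+ 2 & enorm (area_of S J v w) <= ar * e ^+ 2].
    by apply: W_estimates; rewrite // ep lerDr.
  rewrite powR_invE; last exact: addr_ge0.
  exact: (@germ_delta_scale R d dA S A g K gK J u v w sg al ar e sg0 al0 ar0 e0 a1 b1 a2 a3 b4).
rewrite sE /= addr0 in main.
have g0 : `|germ S A g J 0 T| <= K * sg + K * ar.
  apply: (le_trans (germ_bound S A gK _ _ _)).
  have [a1 _ a3] := increments_le (lexx 0) T0 (lexx T).
  by apply: lerD; rewrite ler_wpM2l.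
set c := (1 + (3 / p - 1)^-1) * 6 `^ (3 / p).
have c0 : 0 <= c.
  by rewrite /c mulr_ge0 ?powR_ge0// addr_ge0// invr_ge0 subr_ge0 ltW.
have m6 : (2 * 3 : R) = 6 by ring.
rewrite m6 -!mulrA -/c in main.
have tot : `|psum (germ S A g J) 0 s| <= K * (sg + ar) + K * (Q * c).
  rewrite -[X in `|X|](subrK (germ S A g J 0 T)) addrC mulrDr.
  by apply: (le_trans (ler_normD _ _)); apply: lerD.
apply: (le_trans tot).
set Z := (1 + sg ^+ 2 + al) * (1 + sg) * (2 * sg + ar).
have -> : (1 + c) * K * (1 + sg ^+ 2 + al) * (1 + sg) * (2 * sg + ar) =
  K * Z + K * (Z * c) by rewrite /Z; ring.
have s2 : 0 <= sg ^+ 2 by rewrite exprn_ge0.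
have [sgp alp arp] := And3 sg0 al0 ar0.
pose a := 1 + sg ^+ 2 + al; have a1 : 1 <= a by rewrite /a; lra.
have a0 : 0 <= a by lra.
have ab : a + sg <= a * (1 + sg) by rewrite mulrDr mulr1 lerD2l ler_peMl.
have r0 : 0 <= 2 * sg + ar by lra.
have Z1 : sg + ar <= Z.
  apply: (@le_trans _ _ (2 * sg + ar)); first lra.
  by rewrite /Z ler_peMl//; apply: le_trans ab; lra.
have ZQ : Q <= Z.
  rewrite /Z mulrDr; apply: lerD.
    apply: ler_pM => //; rewrite ?addr_ge0//; last lra.
    by apply: le_trans ab; rewrite /a; lra.
  by rewrite ler_wpM2r//; apply: le_trans ab; rewrite /a; lra.
by apply: lerD; rewrite ler_wpM2l// ler_wpM2r.
Qed.

End Stability.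

(** * Variation and cadlag functions *)

Section Variation.
Variable R : realType.

(** Nonnegativity lets the exponents 1/q and q cancel when the supremum is recovered from [pvar]. *)
Lemma variation_sup_ge0 m n (q s t : R) (F : R -> R -> 'M[R]_(m, n)) : s < t ->
  (0 <= ereal_sup [set (\sum_(0 <= k < size c)
             enorm (F (nth s (s :: c) k) (nth s c k)) `^ q)%:E
       | c in [set c : seq R | itv_partition s t c]])%E.
Proof.
move=> st; apply: le_ereal_sup_tmp; exists (\sum_(0 <= k < size [:: t])
   enorm (F (nth s (s :: [:: t]) k) (nth s [:: t] k)) `^ q)%:E.
  by exists [:: t] => //; exact: itv_partition1.
by rewrite lee_fin sumr_ge0// => *; exact: powR_ge0.
Qed.

Lemma pvar_ge0 m n (q : R) (F : R -> R -> 'M[R]_(m, n)) s t : (0 <= pvar q F s t)%E.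
Proof. exact: poweR_ge0. Qed.

Lemma pvar_psum m n (q T x : R) (F : R -> R -> 'M[R]_(m, n)) : 0 < q -> 0 < T ->
  pvar q F 0 T = x%:E -> forall c, path <%R 0 c -> last 0 c = T ->
  psum (fun u v => enorm (F u v) `^ q) 0 c <= x `^ q.
Proof.
move=> q0 T0; rewrite /pvar; have := @variation_sup_ge0 m n q 0 T F T0.
set X := ereal_sup _ => X0 Xx c pc lc.
have XE : X = (x `^ q)%:E.
  by rewrite -poweR_EFin -Xx -poweRrM mulVf ?poweRe1// gt_eqF.
rewrite -lee_fin -XE; apply: ereal_sup_ubound; exists c.
  by split; rewrite // lc.
by rewrite psum_nth.
Qed.

Lemma pvar_lty m n (q T B : R) (F : R -> R -> 'M[R]_(m, n)) :
  (forall c, path <%R 0 c -> last 0 c = T ->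
    psum (fun u v => enorm (F u v) `^ q) 0 c <= B) -> (pvar q F 0 T < +oo)%E.
Proof.
move=> h; apply: poweR_lty; apply: (@le_lt_trans _ _ B%:E); last exact: ltry.
apply: ge_ereal_sup => _ [c [pc /eqP lc] <-].
by rewrite lee_fin; have := h c pc lc; rewrite psum_nth.
Qed.

Lemma pvar_lty_control m n (q T B a : R) (W : R -> R -> R) (F : R -> R -> 'M[R]_(m, n)) :
  0 < q -> 0 <= a ->
  (forall c, path <%R 0 c -> last 0 c = T -> psum W 0 c <= B) ->
  (forall u v, 0 <= u -> u < v -> v <= T -> 0 <= W u v /\ enorm (F u v) <= a * W u v `^ q^-1) ->
  (pvar q F 0 T < +oo)%E.
Proof.
move=> q0 a0 WB FW; apply: (@pvar_lty _ _ _ _ (a `^ q * B)) => c pc lc.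
apply: (@le_trans _ _ (a `^ q * psum W 0 c)); last by rewrite ler_wpM2l ?powR_ge0 ?WB.
rewrite -psumZ; apply: ler_psum_consecutive => s1 u v s2 e.
have [um vm uv _] := path_consecutive pc e.
have u0 : 0 <= u := path_ge_head pc um.
have vT : v <= T by rewrite -lc path_le_last// inE vm orbT.
have [W0 h] := FW _ _ u0 uv vT.
have -> : a `^ q * W u v = (a * W u v `^ q^-1) `^ q.
  by rewrite powRM ?powR_ge0// -powRrM mulVf ?powRr1 ?gt_eqF.
by rewrite ge0_ler_powR ?nnegrE ?enorm_ge0 ?mulr_ge0 ?powR_ge0 ?(ltW q0).
Qed.

Lemma pvar1_psum_le m n (T al : R) (F : R -> R -> 'M[R]_(m, n)) : 0 < T ->
  pvar 1 F 0 T = al%:E -> forall s, path <%R 0 s -> last 0 s <= T ->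
  psum (fun u v => enorm (F u v)) 0 s <= al.
Proof.
move=> T0 e s ps ls.
have al0 : 0 <= al by rewrite -lee_fin -e pvar_ge0.
have E c : psum (fun u v => enorm (F u v) `^ 1) 0 c = psum (fun u v => enorm (F u v)) 0 c.
  by apply: eq_psum_consecutive => *; rewrite powRr1 ?enorm_ge0.
have h c : path <%R 0 c -> last 0 c = T -> psum (fun u v => enorm (F u v)) 0 c <= al.
  move=> pc lc; have := @pvar_psum _ _ 1 T al F ltr01 T0 e c pc lc.
  by rewrite E powRr1.
move: ls; rewrite le_eqVlt => /orP[/eqP|lT]; first exact: h.
apply: le_trans (h (rcons s T) _ _); rewrite ?last_rcons ?rcons_path ?ps//.
by rewrite -cats1 psum_cat /= addr0 lerDl enorm_ge0.
Qed.

End Variation.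

(** * Closure of cadlag functions under continuous operations *)

Section CadlagClosure.
Variables (R : realType).

Lemma cvg_matrix T (F : set_system T) (FF : Filter F) m n (f : T -> 'M[R]_(m, n)) (L : 'M[R]_(m, n)) :
  (forall i j, f x i j @[x --> F] --> L i j) -> f @ F --> L.
Proof.
move=> h B [Q QL QB]; rewrite /nbhs /=.
have : \forall x \near F, forall ij : 'I_m * 'I_n, Q ij.1 ij.2 (f x ij.1 ij.2).
  by apply: filter_forall => -[i j]; apply: h; exact: QL.
by apply: filterS => x hx; apply: QB => i j; exact: (hx (i, j)).
Qed.

Lemma cvg_coord T (F : set_system T) (FF : Filter F) m n (f : T -> 'M[R]_(m, n)) (L : 'M[R]_(m, n)) i j :
  f @ F --> L -> f x i j @[x --> F] --> L i j.
Proof. by move=> fL; exact: (cvg_comp _ _ fL (@coord_continuous R m n i j L)). Qed.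

Lemma cvg_mulmx T (F : set_system T) (FF : Filter F) m n k
  (f : T -> 'M[R]_(m, n)) (g : T -> 'M[R]_(n, k)) (a : 'M[R]_(m, n)) (b : 'M[R]_(n, k)) :
  f @ F --> a -> g @ F --> b -> (f x *m g x) @[x --> F] --> a *m b.
Proof.
move=> fa gb; apply: cvg_matrix => i j; rewrite mxE.
under eq_fun do rewrite mxE.
apply: cvg_big => [|l _]; first exact: add_continuous.
by apply: cvgM; apply: cvg_coord.
Qed.

Lemma cvg_row_mx T (F : set_system T) (FF : Filter F) m n k
  (f : T -> 'M[R]_(m, n)) (g : T -> 'M[R]_(m, k)) (a : 'M[R]_(m, n)) (b : 'M[R]_(m, k)) :
  f @ F --> a -> g @ F --> b -> row_mx (f x) (g x) @[x --> F] --> row_mx a b.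
Proof.
move=> fa gb; apply: cvg_matrix => i j; rewrite mxE.
under eq_fun do rewrite mxE.
by case: splitP => l _; apply: cvg_coord.
Qed.

Lemma cvg_usubmx T (F : set_system T) (FF : Filter F) m n k
  (f : T -> 'M[R]_(m + n, k)) (a : 'M[R]_(m + n, k)) :
  f @ F --> a -> usubmx (f x) @[x --> F] --> usubmx a.
Proof.
move=> fa; apply: cvg_matrix => i j; rewrite mxE.
by under eq_fun do rewrite mxE; apply: cvg_coord.
Qed.

Variables U V W : normedModType R.

Lemma cadlag_sub (D E : set R) (f : R -> V) : E `<=` D -> cadlag D f -> cadlag E f.
Proof.
move=> ED cf t /ED Dt; have [fr fl] := cf t Dt.
have sub (G : set_system R) : Filter G -> within E G `=>` within D G.
  by move=> FG B; rewrite /within /=; apply: filterS => x h /ED/h.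
split; first exact: (cvg_trans (cvg_fmap2 (sub _ _)) fr).
apply/cvg_ex; exists (lim (f x @[x --> within D t^'-])).
exact: (cvg_trans (cvg_fmap2 (sub _ _)) fl).
Qed.

Lemma cadlag_cst (D : set R) (a : V) : cadlag D (fun _ => a).
Proof. by move=> t _; split; [exact: cvg_cst|exact: is_cvg_cst]. Qed.

(** Preservation of limits is asked along every filter, since it serves both the right and the left
    filters within [D]. *)
Lemma cadlag_map2 (D : set R) (h : U -> V -> W) (f : R -> U) (g : R -> V) :
  (forall F : set_system R, Filter F ->
    forall f g a b, f @ F --> a -> g @ F --> b ->
    h (f x) (g x) @[x --> F] --> h a b) ->
  cadlag D f -> cadlag D g -> cadlag D (fun t => h (f t) (g t)).
Proof.
move=> hc cf cg t Dt; have [fr /cvg_ex[l fl]] := cf t Dt.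
have [gr /cvg_ex[l' gl]] := cg t Dt.
by split; [exact: hc|apply/cvg_ex; exists (h l l'); exact: hc].
Qed.

End CadlagClosure.

(** * The norm of C^2_b *)

Section C2bNorm.
Variables (R : realType) (l m : nat).
Implicit Types f g : 'rV[R]_l -> 'rV[R]_m.

Lemma hess_norm_ge0 f x : 0 <= hess_norm f x.
Proof. exact: sqrtr_ge0. Qed.

Lemma ereal_sup_range_ge0 (h : 'rV[R]_l -> R) : (forall x, 0 <= h x) ->
  (0 <= ereal_sup (range (fun x => (h x)%:E)))%E.
Proof. by move=> h0; apply: le_ereal_sup_tmp; exists (h 0)%:E; [exists 0|rewrite lee_fin]. Qed.

Lemma C2b_norm_ge0 f : (0 <= C2b_norm f)%E.
Proof.
rewrite /C2b_norm !adde_ge0//; apply: ereal_sup_range_ge0 => x;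
  by rewrite ?enorm_ge0 ?hess_norm_ge0.
Qed.

Lemma C2b_norm_C2_le f K : (forall x, differentiable f x) ->
  (forall x, differentiable (jacobian f) x) -> C2b_norm f = K%:E -> C2_le f K.
Proof.
move=> df dJ e.
have s1 := @ereal_sup_range_ge0 (fun x => enorm (f x)) (fun x => enorm_ge0 _).
have s2 := @ereal_sup_range_ge0 (fun x => enorm (jacobian f x)) (fun x => enorm_ge0 _).
have s3 := @ereal_sup_range_ge0 (hess_norm f) (hess_norm_ge0 f).
split => // x; rewrite -lee_fin -e /C2b_norm.
- apply: (@le_trans _ _ (ereal_sup (range (fun x => (enorm (f x))%:E)))).
    by apply: ereal_sup_ubound; exists x.
  by rewrite -addeA leeDl// adde_ge0.
- apply: (@le_trans _ _ (ereal_sup (range (fun x => (enorm (jacobian f x))%:E)))).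
    by apply: ereal_sup_ubound; exists x.
  by rewrite addeAC leeDr// adde_ge0.
- apply: (@le_trans _ _ (ereal_sup (range (fun x => (hess_norm f x)%:E)))).
    by apply: ereal_sup_ubound; exists x.
  by rewrite leeDr// adde_ge0.
Qed.

Lemma C2b_C2_le f : C2b f -> exists K, C2b_norm f = K%:E /\ C2_le f K.
Proof.
move=> [df dJ _ fin].
have e : C2b_norm f = (fine (C2b_norm f))%:E.
  by rewrite fineK// ge0_fin_numE// C2b_norm_ge0.
by exists (fine (C2b_norm f)); split => //; apply: C2b_norm_C2_le.
Qed.

Lemma jacobianB f g x : differentiable f x -> differentiable g x ->
  jacobian (f \- g) x = jacobian f x - jacobian g x.
Proof.
move=> df dg.
have E (v : 'rV[R]_l) : v *m jacobian (f \- g) x = v *m jacobian f x - v *m jacobian g x.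
  rewrite -[LHS](diff_jacobian (f \- g) x v).
  have e2 : 'd (f \- g) x v = 'd f x v - 'd g x v.
    exact: (congr1 (fun h => h v) (diffB df dg)).
  rewrite [LHS]e2.
  exact: (congr2 (fun a b => a - b) (diff_jacobian f x v) (diff_jacobian g x v)).
apply/row_matrixP => i; rewrite [LHS]rowE [RHS]rowE [RHS]mulmxBr.
exact: E.
Qed.

(** Crude bounds suffice to show that the norm of the difference is finite; its exact value is then
    the [K] of the stability estimate. *)
Lemma C2_leB f g Kf Kg : C2_le f Kf -> C2_le g Kg ->
  exists K, C2b_norm (f \- g)%R = K%:E /\ C2_le (f \- g) K.
Proof.
move=> fK gK; have [df dJf bf bJf _] := fK; have [dg dJg bg bJg _] := gK.
have dB x : differentiable (f \- g) x by exact: differentiableB.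
have JB : jacobian (f \- g) = jacobian f - jacobian g.
  by apply/funext => x; rewrite jacobianB.
have dJB x : differentiable (jacobian (f \- g)) x.
  rewrite JB; exact: (differentiableB (dJf x) (dJg x)).
have bnd (h : 'rV[R]_l -> R) (B : R) : (forall x, h x <= B) ->
    (ereal_sup (range (fun x => (h x)%:E)) < +oo)%E.
  move=> hB; apply: (@le_lt_trans _ _ B%:E); last exact: ltry.
  by apply: ge_ereal_sup => _ [x _ <-]; rewrite lee_fin.
have fin : (C2b_norm (f \- g)%R < +oo)%E.
  rewrite /C2b_norm !lte_add_pinfty//.
  - apply: (bnd _ (Kf + Kg)) => x /=; apply: (le_trans (ler_enormB _ _)).
    exact: lerD.
  - apply: (bnd _ (Kf + Kg)) => x; rewrite jacobianB//.
    by apply: (le_trans (ler_enormB _ _)); exact: lerD.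
  - apply: (bnd _ (Num.sqrt (\sum_(k < l) (Kf * enorm (delta_mx 0 k : 'rV[R]_l) +
        Kg * enorm (delta_mx 0 k : 'rV[R]_l)) ^+ 2))) => x.
    rewrite /hess_norm ler_sqrt; last by apply: sumr_ge0 => k _; exact: sqr_ge0.
    apply: ler_sum => k _; rewrite JB.
    have -> : 'd (jacobian f - jacobian g) x (delta_mx 0 k) =
        'd (jacobian f) x (delta_mx 0 k) - 'd (jacobian g) x (delta_mx 0 k).
      exact: (congr1 (fun h => h (delta_mx 0 k)) (diffB (dJf x) (dJg x))).
    set e := enorm (delta_mx 0 k : 'rV[R]_l).
    have c0 : 0 <= Kf * e + Kg * e.
      by rewrite addr_ge0// mulr_ge0 ?enorm_ge0 ?(C2_le_ge0 fK) ?(C2_le_ge0 gK).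
    rewrite ler_pXn2r ?nnegrE ?enorm_ge0 ?c0//.
    apply: (le_trans (ler_enormB _ _)).
    by apply: lerD; [exact: (enorm_diff_jacobian fK)|exact: (enorm_diff_jacobian gK)].
have e : C2b_norm (f \- g)%R = (fine (C2b_norm (f \- g)%R))%:E.
  by rewrite fineK// ge0_fin_numE// C2b_norm_ge0.
by exists (fine (C2b_norm (f \- g)%R)); split => //; apply: C2b_norm_C2_le.
Qed.

End C2bNorm.

(** * Admissibility *)

Section Admissibility.
Variables (R : realType) (p : R) (d dA : nat).
Variables (S : R -> 'rV[R]_d) (A : R -> 'rV[R]_dA) (P : nat -> set R).
Hypotheses (p_gt2 : 2 < p) (p_lt3 : p < 3).
Hypothesis ppS : price_path p P S.
Hypothesis cA : cadlag `[0, +oo[ A.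
Hypothesis jA : jump_times A `<=` \bigcup_n P n.

Let lfP : forall n, locfin_partition (P n). Proof. by case: ppS. Qed.
Let p0 : 0 < p. Proof. by apply: lt_trans p_gt2. Qed.

(** A time outside all partitions is interior to an interval of each of them, where [S] eventually
    oscillates little. Thus (RIE) itself confines the jumps of [S] to partition points. *)
Lemma price_path_left_continuous t : 0 < t -> ~ (\bigcup_n P n) t ->
  S x @[x --> t^'-] --> S t.
Proof.
move=> t0 nPt; apply: left_cvg => // e e0.
(* The horizon must exceed [t], lest [t] be added to the partitions as their end point. *)
have T0 : 0 < t + 1 by rewrite addr_gt0.
have [_ _ _ _ /(_ _ T0) RS] := ppS.
have e20 : 0 < e / 3 by rewrite divr_gt0.
have [N hN] := RIE_oscillation RS e20.
have tT : t < t + 1 by rewrite ltrDl.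
have R0 : restr_partition (P N) (t + 1) 0.
  by apply/(restr_partitionE lfP); [exact: ltW|right; rewrite ltW//; split => //; exact: partition0].
have [[u v] [suv /= ut tv]] :=
  covering_subitv (finite_upto_restr lfP N (ltW T0) (lexx _)) R0 (ltW t0) tT.
have [/= Ru _ _ _] := suv.
have ut' : u < t.
  rewrite lt_neqAle ut andbT; apply/eqP => e'; apply: nPt; exists N => //.
  move: Ru; rewrite e' => /(restr_partitionE lfP) => /(_ (ltW T0))[h|[]//].
  by move: tT; rewrite -h ltxx.
exists (t - u); first by rewrite subr_gt0.
move=> x x0 xtr xt; have ux : u <= x by move: xtr; rewrite ltr_norml => /andP[]; lra.
apply: (le_lt_trans (normr_le_enorm _)); apply: (le_lt_trans (enorm_distD (S u) _ _)).
rewrite [enorm (S u - _)]enormBC.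
have h1 := hN N (leqnn N) u v t suv ut tv.
have h2 := hN N (leqnn N) u v x suv ux (lt_trans xt tv).
lra.
Qed.

Lemma no_jump_left_continuous t : 0 < t -> ~ (\bigcup_n P n) t ->
  A x @[x --> t^'-] --> A t.
Proof.
move=> t0 nPt; have Dt : `[0, +oo[%classic t by rewrite /= in_itv /= ltW.
have [l hl] := cadlag_osc cA Dt.
have Al : A x @[x --> t^'-] --> l.
  apply: left_cvg => // e /hl[r r0 [h _]]; exists r => // x x0; apply: h.
  by rewrite /= in_itv /= x0.
suff -> : A t = l by [].
apply/eqP; rewrite -subr_eq0; apply: contraPT nPt => nz; apply.
by apply: jA; split => //; rewrite (cvg_lim _ Al).
Qed.

Variables (g : 'rV[R]_(d + dA) -> 'rV[R]_d) (K : R).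
Hypothesis gK : C2_le g K.

Let phi := strategy S A g.
Let phi' := strategy' S A g.

Lemma cvg_strategy (F : set_system R) (FF : Filter F) s t s0 t0 :
  s @ F --> s0 -> t @ F --> t0 ->
  g (row_mx (s x) (t x)) @[x --> F] --> g (row_mx s0 t0).
Proof.
move=> h1 h2; apply: (cvg_comp _ _ (cvg_row_mx FF h1 h2)).
by case: gK => dg _ _ _ _; exact: (differentiable_continuous (dg _)).
Qed.

Lemma jump_times_strategy : jump_times phi `<=` \bigcup_n P n.
Proof.
move=> t [t0 nz]; apply: contrapT => nPt; move/eqP: nz; apply.
apply/eqP; rewrite subr_eq0 eq_sym; apply/eqP; apply: cvg_lim => //.
by apply: cvg_strategy; [exact: price_path_left_continuous|exact: no_jump_left_continuous].
Qed.

Section Horizon.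
Variable T : R.
Hypothesis T0 : 0 < T.
Hypothesis finA : (pvar 1 (incr A) 0 T < +oo)%E.

Let sub0 : `[0, T]%classic `<=` `[0, +oo[%classic.
Proof. by move=> t /=; rewrite !in_itv /= => /andP[->]. Qed.

Let cS : cadlag `[0, T] S. Proof. by apply: cadlag_sub sub0 _; case: ppS. Qed.
Let cA' : cadlag `[0, T] A. Proof. exact: cadlag_sub sub0 cA. Qed.

Lemma cadlag_strategy : cadlag `[0, T] phi.
Proof. exact: (cadlag_map2 (h := fun a b => g (row_mx a b)) cvg_strategy cS cA'). Qed.

Lemma cadlag_strategy' : cadlag `[0, T] phi'.
Proof.
apply: (cadlag_map2 (h := fun a b => usubmx (jacobian g (row_mx a b))) _ cS cA').
move=> F FF s t a b h1 h2; apply: cvg_usubmx.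
apply: (cvg_comp _ _ (cvg_row_mx FF h1 h2)).
by case: gK => _ dJ _ _ _; exact: (differentiable_continuous (dJ _)).
Qed.

Lemma cadlagB (V : normedModType R) (D : set R) (f h : R -> V) :
  cadlag D f -> cadlag D h -> cadlag D (fun t => f t - h t).
Proof. by apply: (cadlag_map2 (h := fun a b => a - b)) => *; exact: cvgB. Qed.

Lemma cadlag_mulmx (D : set R) m n k (f : R -> 'M[R]_(m, n)) (h : R -> 'M[R]_(n, k)) :
  cadlag D f -> cadlag D h -> cadlag D (fun t => f t *m h t).
Proof. by apply: (cadlag_map2 (h := fun a b => a *m b)) => *; exact: cvg_mulmx. Qed.

(** The weight of the convergence argument, packed so that the variations of [S], of the strategy,
    of its derivative and of the remainder are all bounded through one sum. *)
Lemma variation_bounds : exists (W : R -> R -> R) (M : R), [/\ 1 <= M,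
  (forall c, path <%R 0 c -> last 0 c = T -> psum W 0 c <= M),
  (forall u v, 0 <= u -> u < v -> v <= T -> 0 <= W u v),
  (forall u v, 0 <= u -> u < v -> v <= T -> enorm (S v - S u) <= W u v `^ p^-1) &
  (forall u v r, 0 <= u -> u < v -> v <= T -> 0 < r <= 1 ->
     enorm (A v - A u) <= M * W u v `^ r)].
Proof.
have [_ _ _ _ /(_ _ T0) RS] := ppS.
have [w [cw wS _]] := RIE_control T0 RS.
have eA : pvar 1 (incr A) 0 T = (fine (pvar 1 (incr A) 0 T))%:E.
  by rewrite fineK// ge0_fin_numE// pvar_ge0.
set al := fine _ in eA; have varA := pvar1_psum_le T0 eA.
have WB := W_bounds cw varA; have M1 := M_ge1 T0 cw varA.
exists (fun x y => w x y + enorm (A y - A x)), (w 0 T + al + 1); split => //.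
- move=> c pc lc; have h := psum_W cw varA pc; apply: le_trans (h _) _; rewrite ?lc//.
  by rewrite lerBlDr lerDl.
- by move=> u v u0 uv vT; have [h1 h2 _ _] := WB u v u0 uv vT; exact: le_trans h1 h2.
- move=> u v u0 uv vT; have [h1 h2 _ _] := WB u v u0 uv vT.
  apply: (le_trans (enorm_incr_w p_gt2 wS u0 (ltW uv) vT)).
  by rewrite ge0_ler_powR ?nnegrE ?invr_ge0 ?(ltW p0)// (le_trans h1).
- move=> u v r u0 uv vT hr; have [h1 h2 h3 h4] := WB u v u0 uv vT.
  by apply: le_bounded_powR => //; [exact: enorm_ge0|exact: le_trans h3 h4].
Qed.

(** The derivative is Lipschitz in [S] and [A], hence q = p; the remainder is quadratic in [S] and
    linear in [A], hence r = p / 2. *)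
Lemma controlled_strategy : controlled T p p (p / 2) S phi phi'.
Proof.
have [W [M [M1 WM W0 WS WA]]] := variation_bounds.
have K0 := C2_le_ge0 gK; have M0 := le_trans ler01 M1.
have pV : 0 < p^-1 <= 1.
  by rewrite invr_gt0 p0 invf_le1// ltW// (lt_trans _ p_gt2)// ltr1n.
have p2V : 0 < 2 / p <= 1 by rewrite divr_gt0//= ler_pdivrMr// mul1r ltW.
have incr_le u v : 0 <= u -> u < v -> v <= T ->
    K * (enorm (S v - S u) + enorm (A v - A u)) <= K * (1 + M) * W u v `^ p^-1.
  move=> u0 uv vT; rewrite -mulrA ler_wpM2l// mulrDl mul1r; apply: lerD.
    exact: WS.
  exact: WA.
have c0 : 0 <= K * (1 + M) by rewrite mulr_ge0// addr_ge0.
split.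
- split; first exact: cadlag_strategy.
  apply: (pvar_lty_control p0 c0 WM) => u v u0 uv vT; split; first exact: W0.
  by apply: le_trans (incr_le _ _ u0 uv vT); exact: strategy_lipschitz.
- split; first exact: cadlag_strategy'.
  apply: (pvar_lty_control p0 c0 WM) => u v u0 uv vT; split; first exact: W0.
  by apply: le_trans (incr_le _ _ u0 uv vT); exact: strategy'_lipschitz.
split.
- move=> t; rewrite in_itv /= => /andP[t0 tT].
  have st : `[0, t]%classic `<=` `[0, T]%classic.
    by move=> x /=; rewrite !in_itv /= => /andP[-> /le_trans]; apply.
  apply: cadlagB; first by apply: cadlagB; [exact: cadlag_cst|exact: cadlag_sub st cadlag_strategy].
  apply: cadlag_mulmx; last exact: cadlag_sub st cadlag_strategy'.
  by apply: cadlagB; [exact: cadlag_cst|exact: cadlag_sub st cS].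
- move=> s; rewrite in_itv /= => /andP[s0 sT].
  have st : `[s, T]%classic `<=` `[0, T]%classic.
    by move=> x /=; rewrite !in_itv /= => /andP[/(le_trans s0) -> ->].
  apply: cadlagB; first by apply: cadlagB; [exact: cadlag_sub st cadlag_strategy|exact: cadlag_cst].
  apply: cadlag_mulmx; last exact: cadlag_cst.
  by apply: cadlagB; [exact: cadlag_sub st cS|exact: cadlag_cst].
apply: (@pvar_lty_control _ _ _ (p / 2) T M (K * (1 + M)) W) => //; first by rewrite divr_gt0.
move=> u v u0 uv vT; split; first exact: W0.
apply: (le_trans (enorm_remainder S A gK u v)).
rewrite -mulrA ler_wpM2l// mulrDl mul1r invf_div; apply: lerD; last exact: WA.
rewrite powR_invE ?W0// ler_pXn2r ?nnegrE ?enorm_ge0 ?powR_ge0//.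
exact: WS.
Qed.

End Horizon.

Lemma admissible_strategy : (forall T : R, 0 <= T -> (pvar 1 (incr A) 0 T < +oo)%E) ->
  admissible p P S phi.
Proof.
move=> finA; split; last exact: jump_times_strategy.
exists p, (p / 2); split => //.
- by rewrite ltr_pdivlMr// mul1r.
- by rewrite -mulrDl ltr_pdivlMr// mul1r (lt_le_trans p_lt3)//; lra.
- by rewrite -mulrDl div1r invf_div.
- by move=> T T0; exists phi'; apply: controlled_strategy => //; exact/finA/ltW.
Qed.

End Admissibility.

(** * The capital process *)

Section Capital.
Variables (R : realType) (p : R) (d dA : nat).
Variables (S : R -> 'rV[R]_d) (A : R -> 'rV[R]_dA) (P : nat -> set R).
Hypotheses (p_gt2 : 2 < p) (p_lt3 : p < 3).
Hypothesis ppS : price_path p P S.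
Hypothesis cA : cadlag `[0, +oo[ A.
Hypothesis finA : forall T : R, 0 <= T -> (pvar 1 (incr A) 0 T < +oo)%E.
Hypothesis jA : jump_times A `<=` \bigcup_n P n.

Let lfP : forall n, locfin_partition (P n). Proof. by case: ppS. Qed.
Let p0 : 0 < p. Proof. by apply: lt_trans p_gt2. Qed.

Lemma capital_approx g K T : 0 < T -> C2_le g K ->
  forall eta : R, 0 < eta -> exists k N, forall m, (N <= m)%N ->
  forall t, 0 <= t -> t <= T ->
  `|discr_capital (P m) S (strategy S A g) t -
    psum (germ S A g (rie_int (fun n => restr_partition (P n) T) S)) 0
      (pts (restr_partition (P k) t))| <= eta.
Proof.
move=> T0 gK; have [_ _ _ _ /(_ _ T0) RS] := ppS.
have [w [cw wS wJ]] := RIE_control T0 RS.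
have eA : pvar 1 (incr A) 0 T = (fine (pvar 1 (incr A) 0 T))%:E.
  by rewrite fineK// ge0_fin_numE ?pvar_ge0// finA// ltW.
exact: (discr_capital_approx p_gt2 p_lt3 ppS T0 cw wS wJ (pvar1_psum_le T0 eA) gK cA jA).
Qed.

Lemma capital_cvg g K t : 0 <= t -> C2_le g K ->
  discr_capital (P n) S (strategy S A g) t @[n --> \oo] -->
  capital P S (strategy S A g) t.
Proof.
move=> t0 gK; apply: cauchy_cvg; apply: cauchy_exP => e e0.
have T0 : 0 < t + 1 by rewrite ltr_wpDl.
have [k [N h]] := capital_approx T0 gK (divr_gt0 e0 (ltr0n R 2)).
exists (psum (germ S A g (rie_int (fun n => restr_partition (P n) (t + 1)) S)) 0
      (pts (restr_partition (P k) t))); exists N => // m Nm.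
rewrite /= -ball_normE /= distrC; apply: le_lt_trans (h m Nm t t0 _) _; last lra.
by rewrite lerDl.
Qed.

Lemma capital_approx_uniform g K T : 0 < T -> C2_le g K ->
  forall eta : R, 0 < eta -> exists N, forall m, (N <= m)%N ->
  forall t, 0 <= t -> t <= T ->
  `|discr_capital (P m) S (strategy S A g) t - capital P S (strategy S A g) t| <= eta.
Proof.
move=> T0 gK eta eta0.
have [k [N h]] := capital_approx T0 gK (divr_gt0 eta0 (ltr0n R 2)).
exists N => m Nm t t0 tT.
have /cvgrPdist_le cv := capital_cvg t0 gK.
(* The indices [m] and [n] are compared through the same sum over [P k]. Only [n] depends on [t],
   and its distance to the limit is an arbitrary [e], so [N] stays uniform in [t]. *)
apply/ler_addgt0Pr => e /cv[M _ hM]; pose n := maxn M N.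
have h0 := hM n (leq_maxl _ _); have h1 := h m Nm t t0 tT.
have h2 := h n (leq_maxr _ _) t t0 tT; rewrite /= in h0 h1 h2.
move: h0 h1 h2; set J := psum _ _ _; set C := capital _ _ _ _.
set V := discr_capital (P m) _ _ _; set V' := discr_capital (P n) _ _ _ => h0 h1 h2.
have -> : V - C = V - J - (V' - J) - (C - V') by ring.
apply: (le_trans (ler_normB _ _)); apply: lerD => //; rewrite [leRHS]splitr.
by apply: (le_trans (ler_normB _ _)); apply: lerD.
Qed.

Lemma capital_uniform g K T : 0 <= T -> C2_le g K ->
  {uniform `[0, T]%classic, (fun n => discr_capital (P n) S (strategy S A g)) @ \oo
     --> capital P S (strategy S A g)}.
Proof.
move=> T0 gK B /uniform_nbhs[E [entE EB]].
rewrite -entourage_ballE in entE; have [e /= e0 eE] := entE.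
have T1 : 0 < T + 1 by rewrite ltr_wpDl.
have [N hN] := capital_approx_uniform T1 gK (divr_gt0 e0 (ltr0n R 2)).
exists N => // m Nm; apply: EB => y; rewrite /= in_itv /= => /andP[y0 yT].
apply: eE; rewrite /= -ball_normE /= distrC.
by apply: le_lt_trans (hN m Nm y y0 _) _; lra.
Qed.

(** (RIE) is available at positive horizons only, so T = 0 is treated apart. *)
Lemma capital0 phi : capital P S phi 0 = 0.
Proof.
apply: cvg_lim => //.
rewrite (_ : (fun n => discr_capital (P n) S phi 0) = (fun _ => 0)); first exact: cvg_cst.
apply/funext => n; rewrite (discr_capital_psum ppS)//.
have [ps lp mp] := pts_restr lfP n (lexx (0 : R)).
have ip : itv_partition 0 0 (pts (restr_partition (P n) 0)) by split => //; apply/eqP.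
rewrite (itv_partitionxx ip).
by [].
Qed.

Lemma capitalB f g Kf Kg t : 0 <= t -> C2_le f Kf -> C2_le g Kg ->
  capital P S (strategy S A f) t - capital P S (strategy S A g) t =
  capital P S (strategy S A (f \- g)) t.
Proof.
move=> t0 fK gK; apply/esym/cvg_lim => //.
rewrite (_ : (fun n => discr_capital (P n) S (strategy S A (f \- g)) t) =
  (fun n => discr_capital (P n) S (strategy S A f) t -
            discr_capital (P n) S (strategy S A g) t)).
  by apply: cvgB; [exact: capital_cvg fK|exact: capital_cvg gK].
apply/funext => n; rewrite !(discr_capital_psum ppS)// -psumB.
by apply: eq_psum_consecutive => *; rewrite -frobBl.
Qed.

Lemma pvar_price_fin T : 0 < T -> (pvar p (incr S) 0 T < +oo)%E.
Proof.
move=> T0.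
have [W [M [M1 WM W0 WS WA]]] := variation_bounds p_gt2 ppS T0 (finA (ltW T0)).
apply: (pvar_lty_control p0 ler01 WM) => u v u0 uv vT; split; first exact: W0.
by rewrite mul1r; exact: WS.
Qed.

Lemma capital_bound g K T sg al ar : 0 < T -> C2_le g K ->
  pvar p (incr S) 0 T = sg%:E -> pvar 1 (incr A) 0 T = al%:E ->
  pvar (p / 2) (rie_area (fun n => restr_partition (P n) T) S) 0 T = ar%:E ->
  `|capital P S (strategy S A g) T| <=
    (1 + (1 + (3 / p - 1)^-1) * 6 `^ (3 / p)) * K *
    (1 + sg ^+ 2 + al) * (1 + sg) * (2 * sg + ar).
Proof.
move=> T0 gK eS eA eJ.
have sg0 : 0 <= sg by rewrite -lee_fin -eS pvar_ge0.
have al0 : 0 <= al by rewrite -lee_fin -eA pvar_ge0.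
have ar0 : 0 <= ar by rewrite -lee_fin -eJ pvar_ge0.
have hS := pvar_psum p0 T0 eS.
have hA c : path <%R 0 c -> last 0 c = T ->
    psum (fun u v => enorm (A v - A u)) 0 c <= al.
  by move=> pc lc; apply: (pvar1_psum_le T0 eA) => //; rewrite lc.
have hJ := pvar_psum (divr_gt0 p0 (ltr0n R 2)) T0 eJ.
apply/ler_addgt0Pr => eta eta0; have eta2 : 0 < eta / 2 by rewrite divr_gt0.
have [k [N h]] := capital_approx T0 gK eta2.
have [N' h'] := capital_approx_uniform T0 gK eta2.
pose m := maxn N N'.
have h1 := h m (leq_maxl _ _) T (ltW T0) (lexx T).
have h2 := h' m (leq_maxr _ _) T (ltW T0) (lexx T).
have [ps lp _] := pts_restr lfP k (ltW T0).
have h3 := germ_sum_bound p_gt2 p_lt3 T0 gK sg0 al0 ar0 hS hA hJ ps lp.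
move: h1 h2 h3; set J := psum _ _ _; set V := discr_capital _ _ _ _.
set C := capital _ _ _ _; set B := (_ * (2 * sg + ar)) => h1 h2 h3.
have -> : C = J + (V - J) - (V - C) by ring.
have t1 := ler_normB (J + (V - J)) (V - C); have t2 := ler_normD J (V - J).
lra.
Qed.

Lemma capital_bound_ereal g K T : 0 <= T -> C2_le g K ->
  (`|capital P S (strategy S A g) T|%:E <=
   (1 + (1 + (3 / p - 1)^-1) * 6 `^ (3 / p))%:E * K%:E *
   (1 + pvar p (incr S) 0 T ^+ 2 + pvar 1 (incr A) 0 T) *
   (1 + pvar p (incr S) 0 T) *
   rough_norm T p (fun n => restr_partition (P n) T) S)%E.
Proof.
move=> T0 gK; have K0 := C2_le_ge0 gK.
set c := 1 + _; have c0 : 0 < c.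
  rewrite ltr_wpDr// mulr_ge0 ?powR_ge0// addr_ge0// invr_ge0 subr_ge0.
  by rewrite ler_pdivlMr// mul1r ltW.
have S0 := pvar_ge0 p (incr S) 0 T; have A0 := pvar_ge0 1 (incr A) 0 T.
set rie := fun n => restr_partition (P n) T.
have J0 := pvar_ge0 (p / 2) (rie_area rie S) 0 T.
have f1 : (1 <= 1 + pvar p (incr S) 0 T ^+ 2 + pvar 1 (incr A) 0 T)%E.
  by rewrite -addeA leeDl// adde_ge0// expe_ge0.
have f2 : (1 <= 1 + pvar p (incr S) 0 T)%E by rewrite leeDl.
have f3 : (0 <= rough_norm T p rie S)%E by rewrite /rough_norm adde_ge0// mule_ge0.
have lt01 : (0 < 1 :> \bar R)%E by rewrite lte_fin.
have triv : capital P S (strategy S A g) T = 0 ->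
  (`|capital P S (strategy S A g) T|%:E <= c%:E * K%:E *
   (1 + pvar p (incr S) 0 T ^+ 2 + pvar 1 (incr A) 0 T) *
   (1 + pvar p (incr S) 0 T) * rough_norm T p rie S)%E.
  move=> ->; rewrite normr0 !mule_ge0// ?lee_fin ?(ltW c0)//.
    exact: le_trans (ltW lt01) f1.
  exact: le_trans (ltW lt01) f2.
have [e|Tn] := eqVneq T 0; first by apply: triv; rewrite e capital0.
have Tp : 0 < T by rewrite lt_neqAle eq_sym Tn.
(* Set apart because 0 * +oo = 0: the right side then vanishes whatever the variations are, and so
   must the capital. *)
have [e|Kn] := eqVneq K 0.
  apply: triv; apply: cvg_lim => //.
  rewrite (_ : (fun n => _) = (fun _ => 0)); first exact: cvg_cst.
  apply/funext => n; rewrite (discr_capital_psum ppS)//.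
  rewrite (@eq_psum_consecutive _ _ _ (fun _ _ => 0)); first by rewrite psum_const mul0rn.
  move=> _ u v _ _; have := enorm_strategy S A gK u.
  rewrite e => le0; have /eqP : enorm (strategy S A g u) = 0.
    by apply/le_anti; rewrite le0 enorm_ge0.
  by rewrite enorm_eq0 => /eqP ->; rewrite frobC frob0r.
have Kp : 0 < K by rewrite lt_neqAle eq_sym Kn.
have eS : pvar p (incr S) 0 T = (fine (pvar p (incr S) 0 T))%:E.
  by rewrite fineK// ge0_fin_numE// pvar_price_fin.
have eA : pvar 1 (incr A) 0 T = (fine (pvar 1 (incr A) 0 T))%:E.
  by rewrite fineK// ge0_fin_numE// finA.
(* An infinite p/2-variation of the area would make the right side +oo, as all other factors are now
   positive. *)
have [fJ|] := boolP (pvar (p / 2) (rie_area rie S) 0 T \is a fin_num); last first.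
  rewrite ge0_fin_numE// -leNgt leye_eq => /eqP eJ.
  have -> : rough_norm T p rie S = +oo%E.
    by rewrite /rough_norm eJ eS -EFinM.
  rewrite gt0_muley ?leey// !mule_gt0 ?lte_fin//.
    exact: lt_le_trans lt01 f1.
  exact: lt_le_trans lt01 f2.
have eJ := esym (fineK fJ).
have := capital_bound Tp gK eS eA eJ; rewrite -lee_fin.
by rewrite /rough_norm eS eA eJ -EFin_expe !EFinM !EFinD !EFinM.
Qed.

End Capital.

Theorem proposition3p6 (R : realType) (p : R) (p_gt2 : 2 < p) (p_lt3 : p < 3) :
  exists C : R,
  forall (d dA : nat) (S : R -> 'rV[R]_d) (P : nat -> set R)
    (A : R -> 'rV[R]_dA),
  price_path p P S ->
  cadlag `[0, +oo[ A ->
  (forall T : R, 0 <= T -> (pvar 1 (incr A) 0 T < +oo)%E) ->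
  jump_times A `<=` \bigcup_n P n ->
  forall f ftilde : 'rV[R]_(d + dA) -> 'rV[R]_d,
  C2b f -> C2b ftilde ->
  let phi (g : 'rV[R]_(d + dA) -> 'rV[R]_d) (t : R) :=
    g (row_mx (S t) (A t)) in
  [/\ admissible p P S (phi f),
      forall T : R, 0 <= T ->
        {uniform `[0, T]%classic,
          (fun n => discr_capital (P n) S (phi f)) @ \oo
            --> capital P S (phi f)}
    & forall T : R, 0 <= T ->
        (`|capital P S (phi f) T - capital P S (phi ftilde) T|%:E <=
         C%:E * C2b_norm (f \- ftilde)%R *
         (1 + pvar p (incr S) 0 T ^+ 2 + pvar 1 (incr A) 0 T) *
         (1 + pvar p (incr S) 0 T) *
         rough_norm T p (fun n => restr_partition (P n) T) S)%E].
Proof.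
exists (1 + (1 + (3 / p - 1)^-1) * 6 `^ (3 / p)) => d dA S P A ppS cA finA jA f g.
move=> /C2b_C2_le[Kf [_ fK]] /C2b_C2_le[Kg [_ gK]] phi.
split=> [|T T0|T T0].
- exact: (admissible_strategy p_gt2 p_lt3 ppS cA jA fK finA).
- exact: (capital_uniform p_gt2 p_lt3 ppS cA finA jA T0 fK).
have [K [-> hK]] := C2_leB fK gK.
rewrite (capitalB p_gt2 p_lt3 ppS cA finA jA T0 fK gK).
exact: (capital_bound_ereal p_gt2 p_lt3 ppS cA finA jA T0 hK).
Qed.
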